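(* Let $(M,\omega)$ be a $2n$-dimensional symplectic manifold equipped with an effective Hamiltonian $S^1$-action with a moment map $H\colon M\to\mathbb{R}$. Suppose that $L$ is an $S^1$-invariant Lagrangian submanifold of $(M,\omega)$ lying on some level set of $H$. Then for any gradient holomorphic disc $u\colon(\mathbb{D},\partial\mathbb{D})\to(M,L)$ the Maslov index satisfies $$\mu([u])=-2n_z,$$ where $n_z$ is the sum of the weights of the $S^1$-action at the unique fixed point $z$ in $u(\mathbb{D})$. In particular, if the action is semifree and $H(z)$ is the maximum of $H$, then $\mu([u])$ equals the (real) codimension in $M$ of the maximal fixed component of the action (the connected component of $M^{S^1}$ containing $z$).
   Context: Conventions. $S^1=\mathbb{R}/2\pi\mathbb{Z}$, $\xi$ is the vector field generated by the $S^1$-action, and a moment map $H$ satisfies $\iota_\xi\omega=-dH$. $J$ denotes an $S^1$-invariant $\omega$-compatible almost complex structure, with the sign convention that $g_J(\cdot,\cdot):=\omega(J\cdot,\cdot)$ is a Riemannian metric; then $\nabla H=J\xi$. The vector field $J\xi$ is assumed complete and $\gamma_s$ denotes its flow. Gradient holomorphic disc. Let $p\in M$ have trivial stabilizer, so $\sigma_p:=S^1\cdot p$ is a free orbit, and suppose $\gamma_s(p)$ converges to a fixed point $z_p\in M^{S^1}$ as $s\to+\infty$. The map $u\colon\mathbb{R}_{\ge0}\times S^1\to M$, $u(s,t)=\gamma_s(t\cdot p)$, is $(j,J)$-holomorphic for $j\,\partial_t=\partial_s$, $j\,\partial_s=-\partial_t$. Identifying $\mathbb{R}_{\ge0}\times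 S^1$ with the punctured closed unit disc $\mathbb{D}\setminus\{0\}\subset\mathbb{C}$ by $(s,t)\mapsto e^{-(s+it)}$ (so that the disc has positive symplectic area), $u$ extends to a map $u_p^J\colon\mathbb{D}\to M$ with $u_p^J(0)=z_p$ and $u_p^J(\partial\mathbb{D})=\sigma_p$, called the gradient $J$-holomorphic disc of $\sigma_p$. A gradient holomorphic disc $(\mathbb{D},\partial\mathbb{D})\to(M,L)$ is such a disc $u_p^J$ with $p\in L$; the unique fixed point in its image is $z=z_p$. Weights. At a fixed point $z$ there are local coordinates $(z_1,\dots,z_n)$ centered at $z$ with $\omega=\frac{i}{2}\sum dz_k\wedge d\bar z_k$ in which $t\in S^1$ acts by $(z_1,\dots,z_n)\mapsto(t^{c_1}z_1,\dots,t^{c_n}z_n)$ and $H=H(z)+\frac12\sum c_k|z_k|^2$; the integers $c_1,\dots,c_n$ are the weights at $z$. The action is semifree if it is free on the complement of the fixed point set. $\mu\colon\pi_2(M,L)\to\mathbb{Z}$ is the Maslov index. *)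

(* Defs.v *)
From HB Require Import structures.
From mathcomp Require Import all_boot all_order all_algebra.
From mathcomp Require Import complex.
From mathcomp Require Import all_classical all_reals all_analysis.
Set Implicit Arguments.
Unset Strict Implicit.
Unset Printing Implicit Defensive.
Import Order.TTheory GRing.Theory Num.Theory.
Import numFieldNormedType.Exports.
Local Open Scope classical_set_scope.
Local Open Scope ring_scope.

Fixpoint Ck_on (R : realType) (V W : normedModType R) (k : nat) (U : set V)
    (f : V -> W) : Prop :=
  if k is k'.+1 then
    (forall x, U x -> differentiable f x) /\
    (forall v, Ck_on k' U (fun x => 'D_v f x))
  else forall x, U x -> {for x, continuous f}.

Definition smooth_on (R : realType) (V W : normedModType R) (U : set V)
    (f : V -> W) := forall k, Ck_on k U f.

(* [cmap] is a homeomorphism of the open set [cdom] onto the open set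
   [cim], with inverse [cinv]; both functions are total and their values
   off these sets are irrelevant. *)
Record chart (R : realType) (T : topologicalType) (m : nat) := Chart {
  cdom : set T;
  cmap : T -> 'rV[R]_m;
  cinv : 'rV[R]_m -> T;
  cdom_open : open cdom;
  cim_open : open (cmap @` cdom);
  cmapK : forall x, cdom x -> cinv (cmap x) = x;
  cmap_continuous : forall x, cdom x -> {for x, continuous cmap};
  cinv_continuous : forall x, cdom x -> {for cmap x, continuous cinv} }.

Definition cim (R : realType) (T : topologicalType) (m : nat)
  (c : chart R T m) : set 'rV[R]_m := cmap c @` cdom c.

Definition smooth_transition (R : realType) (T : topologicalType) (m : nat)
    (c d : chart R T m) :=
  smooth_on (cmap c @` (cdom c `&` cdom d)) (cmap d \o cinv c).

(* The smooth atlas is the range of [chart_at]. The tangent space at [x] is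
   'rV[R]_m, a row vector standing for the tangent vector with these
   coordinates in the preferred chart [chart_at x]; linear maps act on the
   right. Hence a vector field is a function [M -> 'rV[R]_m], a bilinear form
   or an endomorphism field a function [M -> 'M[R]_m], and smoothness is
   imposed on their expressions in the charts, not on these functions. *)
Record manifold (R : realType) (m : nat) := Manifold {
  msort :> topologicalType;
  mhausdorff : hausdorff_space msort;
  msecond_countable : @second_countable msort;
  chart_at : msort -> chart R msort m;
  chart_at_dom : forall x, cdom (chart_at x) x;
  chart_at_smooth : forall x y, smooth_transition (chart_at x) (chart_at y) }.

Section Manifold.
Context {R : realType} {m : nat} {M : manifold R m}.

(* membership in the maximal atlas *)
Definition smooth_chart (c : chart R M m) :=
  forall x : M, smooth_transition c (chart_at x) /\
                smooth_transition (chart_at x) c.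

Definition coord (x : M) : 'rV[R]_m := cmap (chart_at x) x.

(* d c : T_x M -> R^m *)
Definition chart_diff (c : chart R M m) (x : M) : 'M[R]_m :=
  jacobian (cmap c \o cinv (chart_at x)) (coord x).

(* d (c^-1) : R^m -> T_x M at the point y = c x of R^m *)
Definition chart_inv_diff (c : chart R M m) (y : 'rV[R]_m) : 'M[R]_m :=
  jacobian (cmap (chart_at (cinv c y)) \o cinv c) y.

Definition tangent_map (f : M -> M) (x : M) : 'M[R]_m :=
  jacobian (cmap (chart_at (f x)) \o f \o cinv (chart_at x)) (coord x).

Definition differential (H : M -> R) (x : M) (v : 'rV[R]_m) : R :=
  'D_v (H \o cinv (chart_at x)) (coord x).

Definition smooth_function (H : M -> R) :=
  forall x : M, smooth_on (cim (chart_at x)) (H \o cinv (chart_at x)).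

(* the bilinear form [w] in the coordinates of [c] *)
Definition form_in (c : chart R M m) (w : M -> 'M[R]_m) (y : 'rV[R]_m)
    : 'M[R]_m :=
  chart_inv_diff c y *m w (cinv c y) *m (chart_inv_diff c y)^T.

(* the endomorphism [J] in the coordinates of [c] *)
Definition endo_in (c : chart R M m) (J : M -> 'M[R]_m) (y : 'rV[R]_m)
    : 'M[R]_m :=
  chart_inv_diff c y *m J (cinv c y) *m chart_diff c (cinv c y).

Definition ev (w : M -> 'M[R]_m) (x : M) (v v' : 'rV[R]_m) : R :=
  (v *m w x *m v'^T) 0 0.

Record symplectic_form (w : M -> 'M[R]_m) : Prop := SymplecticForm {
  sympl_smooth : forall x : M, smooth_on (cim (chart_at x))
    (form_in (chart_at x) w);
  sympl_alt : forall x v, ev w x v v = 0;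
  sympl_nondeg : forall x, w x \in unitmx;
  sympl_closed : forall (x : M) (y : 'rV[R]_m) (i j k : 'I_m),
    cim (chart_at x) y ->
    let W (j k : 'I_m) (y : 'rV[R]_m) : R := form_in (chart_at x) w y j k in
    let d (i : 'I_m) (f : 'rV[R]_m -> R) : R := 'D_(delta_mx 0 i) f y in
    d i (W j k) + d j (W k i) + d k (W i j) = 0 }.

Record smooth_Raction (a : R -> M -> M) : Prop := SmoothRaction {
  ract0 : forall x, a 0 x = x;
  ractD : forall s t x, a (s + t) x = a s (a t x);
  ract_continuous : continuous (fun tx : R * M => a tx.1 tx.2);
  ract_smooth : forall x y : M,
    smooth_on [set ty : R * 'rV[R]_m | cim (chart_at x) ty.2 /\
                 cdom (chart_at y) (a ty.1 (cinv (chart_at x) ty.2))]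
      (fun ty : R * 'rV[R]_m =>
         cmap (chart_at y) (a ty.1 (cinv (chart_at x) ty.2))) }.

Definition generator (a : R -> M -> M) (x : M) : 'rV[R]_m :=
  'D_1 (fun t : R => cmap (chart_at x) (a t x)) 0.

(* the flow of a complete vector field is the smooth R-action it generates *)
Definition is_flow (g : R -> M -> M) (X : M -> 'rV[R]_m) :=
  smooth_Raction g /\ forall x, generator g x = X x.

(* S^1 = R / 2 pi Z *)
Definition in_2piZ (t : R) := exists k : int, t = (2 * pi) *~ k.

Definition S1_action (a : R -> M -> M) :=
  smooth_Raction a /\ forall x, a (2 * pi) x = x.

Definition effective (a : R -> M -> M) :=
  forall t, (forall x, a t x = x) -> in_2piZ t.

Definition trivial_stabilizer (a : R -> M -> M) (x : M) :=
  forall t, a t x = x -> in_2piZ t.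

Definition fixed_points (a : R -> M -> M) : set M :=
  [set x | forall t, a t x = x].

Definition semifree (a : R -> M -> M) :=
  forall x, ~ fixed_points a x -> trivial_stabilizer a x.

Definition moment_map (w : M -> 'M[R]_m) (a : R -> M -> M) (H : M -> R) :=
  smooth_function H /\
  forall x v, ev w x (generator a x) v = - differential H x v.

Definition hamiltonian_S1_action (w : M -> 'M[R]_m) (a : R -> M -> M)
    (H : M -> R) :=
  [/\ S1_action a,
      forall t x, tangent_map (a t) x *m w (a t x) *m
                  (tangent_map (a t) x)^T = w x
    & moment_map w a H].

(* The metric is w(J v, v'), not w(v, J v'). *)
Record compatible_acs (w : M -> 'M[R]_m) (J : M -> 'M[R]_m) : Prop :=
  CompatibleAcs {
    acs_smooth : forall x : M, smooth_on (cim (chart_at x))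
      (endo_in (chart_at x) J);
    acs_sq : forall x, J x *m J x = - 1%:M;
    acs_inv : forall x v v', ev w x (v *m J x) (v' *m J x) = ev w x v v';
    acs_pos : forall x v, v != 0 -> 0 < ev w x (v *m J x) v }.

Definition invariant_acs (a : R -> M -> M) (J : M -> 'M[R]_m) :=
  forall t x, J x *m tangent_map (a t) x = tangent_map (a t) x *m J (a t x).

(* Near [x], [S] is an embedded submanifold of dimension [d]. *)
Definition submanifold_at (S : set M) (d : nat) (x : M) :=
  (d <= m)%N /\
  exists c, [/\ smooth_chart c, cdom c x &
    forall y, cdom c y ->
      (S y <-> forall j : 'I_m, (d <= j)%N -> cmap c y 0 j = 0)].

Definition submanifold (S : set M) (d : nat) :=
  forall x, S x -> submanifold_at S d x.

Definition tangent_to (S : set M) (x : M) (v : 'rV[R]_m) :=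
  exists c : R -> M, [/\ c 0 = x, {for 0, continuous c},
    \forall t \near (0 : R), S (c t)
    & is_derive (0 : R) 1 (cmap (chart_at x) \o c) v].

(* The disc lies in R * R, (x, y) standing for x + i y. *)
Definition disc : set (R * R) := [set q | q.1 ^+ 2 + q.2 ^+ 2 <= 1].

(* [g] is the flow of J xi. *)
Record gradient_disc (a g : R -> M -> M) (p z : M) (u : R * R -> M) : Prop :=
  GradientDisc {
    gdisc_free : trivial_stabilizer a p;
    gdisc_fixed : fixed_points a z;
    gdisc_lim : g s p @[s --> +oo] --> z;
    gdisc_continuous : {within disc, continuous u};
    gdisc_center : u (0, 0) = z;
    (* the left-hand argument is e^-(s + i t) *)
    gdisc_eq : forall s t, 0 <= s ->
      u (expR (- s) * cos (- t), expR (- s) * sin (- t)) = g s (a t p) }.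

End Manifold.

Section Symplectic.
Context {R : realType} {n : nat} {M : manifold R (n + n)}.

(* The coordinates of R^(n + n) are (x_1, ..., x_n, y_1, ..., y_n), and
   z_k = x_k + i y_k. *)
Definition xc (y : 'rV[R]_(n + n)) (k : 'I_n) : R := y 0 (lshift n k).
Definition yc (y : 'rV[R]_(n + n)) (k : 'I_n) : R := y 0 (rshift n k).

(* sum_k dx_k /\ dy_k = i/2 sum_k dz_k /\ d(conj z_k) *)
Definition std_form : 'M[R]_(n + n) := block_mx 0 1%:M (- 1%:M) 0.

Definition lagrangian (w : M -> 'M[R]_(n + n)) (L : set M) :=
  submanifold L n /\
  forall x v v', L x -> tangent_to L x v -> tangent_to L x v' ->
    ev w x v v' = 0.

Definition weights_at (w : M -> 'M[R]_(n + n)) (a : R -> M -> M) (H : M -> R)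
    (z : M) (c : 'I_n -> int) :=
  exists f : chart R M (n + n),
    [/\ smooth_chart f, cdom f z, cmap f z = 0,
        forall y, cim f y -> form_in f w y = std_form
      & forall x, cdom f x ->
        let y := cmap f x in
        [/\ forall t, cdom f (a t x),
            (* z_k |-> e^(i c_k t) z_k *)
            forall t k,
              let th := t *~ c k in
              xc (cmap f (a t x)) k = cos th * xc y k - sin th * yc y k /\
              yc (cmap f (a t x)) k = sin th * xc y k + cos th * yc y k
          & H x = H z + 2^-1 * \sum_k (c k)%:~R * (xc y k ^+ 2 + yc y k ^+ 2)]].

(* Continuous symplectic trivialization of u^* T M over the disc:
   [Phi q] maps the standard R^(n + n) to T_(u q) M. *)
Definition symplectic_trivialization (w : M -> 'M[R]_(n + n))
    (u : R * R -> M) (Phi : R * R -> 'M[R]_(n + n)) :=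
  (forall q, disc q -> Phi q *m w (u q) *m (Phi q)^T = std_form) /\
  (forall x : M,
     {within disc `&` u @^-1` cdom (chart_at x),
        continuous (fun q => Phi q *m chart_diff (chart_at x) (u q))}).

(* The matrix X + i Y, where [F] has the blocks X and Y. *)
Definition complex_mx (F : 'M[R]_(n, n + n)) : 'M[R[i]]_n :=
  \matrix_(j, k) Complex (F j (lshift n k)) (F j (rshift n k)).

(* [th] is an argument of det^2 of the subspace spanned by the rows of [F];
   it does not depend on the choice of the basis [F] of this subspace. *)
Definition det2_arg (F : 'M[R]_(n, n + n)) (th : R) :=
  exists2 r : R, 0 < r &
    \det (complex_mx F) ^+ 2 = Complex (r * cos th) (r * sin th).

(* [k] is the Maslov index of the class of [u] in pi_2(M, L): the degree of
   det^2 along the counterclockwise loop of Lagrangian subspaces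
   Phi^-1 (T L) of R^(n + n), for a trivialization Phi of u^* T M. It does not
   depend on Phi, and is 2 for the identity disc in (C, dx /\ dy). *)
Definition maslov_index (w : M -> 'M[R]_(n + n)) (L : set M)
    (u : R * R -> M) (k : int) :=
  [/\ {within disc, continuous u},
      forall t, L (u (cos t, sin t))
    & exists Phi, symplectic_trivialization w u Phi /\
      exists th : R -> R,
        [/\ continuous th,
            th (2 * pi) - th 0 = (2 * pi) *~ k
          & forall t, let q := (cos t, sin t) in
            exists F : 'M[R]_(n, n + n),
              [/\ row_free F,
                  forall v, tangent_to L (u q) v <-> (v <= F *m Phi q)%MS
                & det2_arg F (th t)]]].

End Symplectic.

(* Main.v *)
(* The gradient flow commutes with the circle action, so the disc satisfies
   u(e^(-it) q) = a_t (u q). Hence it suffices to construct a symplectic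
   trivialization Phi of u^*TM with Phi(e^(-it) q) = rotmx(-t) Phi(q) d(a_t), where
   rotmx is the linearized action at z: in such a trivialization the tangent spaces
   of L along the counterclockwise boundary are the images of a single Lagrangian
   subspace under rotmx(-t), and det^2 turns by -2 t sum_k c_k.

   To construct Phi, flow the disc into an invariant Darboux chart at z, where
   the coordinate frame is equivariant, and pull this frame back by small steps
   of the flow, replacing each differential by its complex linear part: this is
   canonical, hence equivariant, and invertible for small times. Initially, the
   chart frame is made complex linear in the same way; this works without any
   smallness because both complex structures are tamed by the same form. Finally
   make the frame unitary by Gram-Schmidt, every step of which is equivariant
   because rotmx is complex diagonal.

   If the action is semifree and H(z) is the maximum, all weights are 0 or -1, and
   near z the fixed points form the coordinate subspace of the zero weights. *)

Require Import Defs.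
From HB Require Import structures.
From mathcomp Require Import all_boot all_order all_algebra.
From mathcomp Require Import complex.
From mathcomp Require Import all_classical all_reals all_analysis.
From mathcomp Require Import ring lra.
Set Implicit Arguments.
Unset Strict Implicit.
Unset Printing Implicit Defensive.
Import Order.TTheory GRing.Theory Num.Theory.
Import numFieldNormedType.Exports.
Local Open Scope classical_set_scope.
Local Open Scope ring_scope.

(** * Calculus in charts *)

(** The differential of the gradient flow intertwines the circle action but need not be J-linear, so
    pulling a frame back along the flow keeps equivariance only. Complex linearity is restored by a
    linear projection, which respects equivariance and continuity and can only destroy
    invertibility. Near the identity it does not, whence the small steps. Their admissible size
    depends on the flow alone, because the projection commutes with complex linear factors, and
    compactness of the disc makes it uniform; so finitely many steps lead back to time 0.

    The sign of the index comes from the parametrization e^(-(s + i t)): the boundary run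
    counterclockwise is the orbit run backwards.

    Tangent vectors are coordinates in a preferred chart that jumps with the point, so [tangent_map]
    and frames need not be continuous as matrices. Every limit is therefore taken after
    multiplication with the differential of a fixed chart. *)

Lemma cvg_mxP (R : realType) (T : Type) (m n : nat) (F : set_system T)
    (FF : Filter F) (f : T -> 'M[R]_(m, n)) (A : 'M[R]_(m, n)) :
  f x @[x --> F] --> A <-> forall i j, f x i j @[x --> F] --> A i j.
Proof.
split=> [fA i j|fA].
  exact: (cvg_comp _ (fun B : 'M[R]_(m, n) => B i j) fA (@coord_continuous _ _ _ i j A)).
apply/cvgrPdist_lt => e e0; near=> x.
rewrite [ltLHS]/Num.Def.normr/= mx_normrE.
apply/bigmax_ltP; split=> // -[i j] _ /=; rewrite !mxE.
move: i j; near: x; apply: filter_forall => i; apply: filter_forall => j.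
by have /cvgrPdist_lt := fA i j; apply.
Unshelve. all: by end_near. Qed.

Lemma cvg_mulmx (R : realType) (T : Type) (m n p : nat) (F : set_system T)
    (FF : Filter F) (f : T -> 'M[R]_(m, n)) (g : T -> 'M[R]_(n, p))
    (A : 'M[R]_(m, n)) (B : 'M[R]_(n, p)) :
  f x @[x --> F] --> A -> g x @[x --> F] --> B ->
  f x *m g x @[x --> F] --> A *m B.
Proof.
move=> /cvg_mxP fA /cvg_mxP gB; apply/cvg_mxP => i j.
rewrite mxE; under eq_cvg do rewrite mxE.
apply: cvg_big => [x y|k _]; first exact: add_continuous.
by apply: cvgM.
Qed.

Lemma cvg_det (R : realType) (T : Type) (n : nat) (F : set_system T)
    (FF : Filter F) (f : T -> 'M[R]_n) (A : 'M[R]_n) :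
  f x @[x --> F] --> A -> \det (f x) @[x --> F] --> \det A.
Proof.
move=> /cvg_mxP fA.
apply: cvg_big => [|s _]; first exact: add_continuous.
apply: cvgM; first exact: cvg_cst.
by apply: cvg_big => [|i _]; first exact: mul_continuous.
Qed.

Lemma cvg_row (R : realType) (T : Type) (m n : nat) (F : set_system T)
    (FF : Filter F) (f : T -> 'M[R]_(m, n)) (A : 'M[R]_(m, n)) i :
  f x @[x --> F] --> A -> row i (f x) @[x --> F] --> row i A.
Proof.
move=> /cvg_mxP fA; apply/cvg_mxP => j k; rewrite mxE.
by under eq_cvg do rewrite mxE; exact: fA.
Qed.

Lemma cvg_trmx (R : realType) (T : Type) (m n : nat) (F : set_system T)
    (FF : Filter F) (f : T -> 'M[R]_(m, n)) (A : 'M[R]_(m, n)) :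
  f x @[x --> F] --> A -> (f x)^T @[x --> F] --> A^T.
Proof.
move=> /cvg_mxP fA; apply/cvg_mxP => j k; rewrite mxE.
by under eq_cvg do rewrite mxE; exact: fA.
Qed.

Lemma near_diff_eq (R : numFieldType) (V W : normedModType R) (f g : V -> W) x :
  (\forall y \near x, f y = g y) -> differentiable f x ->
  differentiable g x /\ 'd g x = 'd f x :> (V -> W).
Proof.
move=> fg df.
have [c e] := (diff_locallyP _ _).1 df.
suff e' : g \o shift x = cst (g x) + 'd f x +o_ 0 id.
  have dE := diff_unique c e'.
  split=> //; apply/diff_locallyP; rewrite dE; split => //.
apply/eqaddoP => _/posnumP[eps].
have /eqaddoP/(_ _ [gt0 of eps%:num]) he := e.
have H0 : \forall y \near (0 : V), f (y + x) = g (y + x).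
  by move: fg; rewrite (near_shift 0 x); apply: filterS => y /=; rewrite subr0.
apply: filterS2 H0 he => y fgy.
by rewrite !fctE /= fgy (nbhs_singleton fg).
Qed.

Lemma mul_jacobian (R : realType) (m n : nat) (f : 'rV[R]_m -> 'rV[R]_n) x v :
  v *m jacobian f x = 'd f x v.
Proof. exact: mul_rV_lin1. Qed.

Lemma mulmx_inj_row (R : realType) (m n : nat) (A B : 'M[R]_(m, n)) :
  (forall v : 'rV_m, v *m A = v *m B) -> A = B.
Proof. by move=> AB; apply/row_matrixP => i; rewrite rowE AB -rowE. Qed.

Lemma jacobian_comp (R : realType) (m n p : nat) (f : 'rV[R]_m -> 'rV[R]_n)
    (g : 'rV[R]_n -> 'rV[R]_p) x :
  differentiable f x -> differentiable g (f x) ->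
  jacobian (g \o f) x = jacobian f x *m jacobian g (f x).
Proof.
move=> df dg; apply: mulmx_inj_row => v; rewrite mulmxA.
transitivity ('d (g \o f) x v); first exact: mul_jacobian.
by rewrite diff_comp// !mul_jacobian.
Qed.

Lemma near_jacobian (R : realType) (m n : nat) (f g : 'rV[R]_m -> 'rV[R]_n) x :
  (\forall y \near x, f y = g y) -> differentiable f x -> jacobian g x = jacobian f x.
Proof.
move=> fg df; have [_ e] := near_diff_eq fg df.
apply: mulmx_inj_row => v.
transitivity ('d g x v); first exact: mul_jacobian.
by rewrite e; apply/esym/mul_jacobian.
Qed.

Lemma jacobian_mulmx (R : realType) (m n : nat) (A : 'M[R]_(m, n)) x :
  differentiable (mulmx^~ A : 'rV[R]_m -> 'rV[R]_n) x /\
  jacobian (mulmx^~ A : 'rV[R]_m -> 'rV[R]_n) x = A.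
Proof.
have c : continuous (mulmxr A : 'rV[R]_m -> 'rV[R]_n).
  move=> y; exact: (@cvg_mulmx R _ 1 m n (nbhs y) _ id (fun=> A) y A cvg_id
    (@cvg_cst _ A _ _ _)).
split.
  exact: (@linear_differentiable _ _ _
    (mulmxr A : {linear 'rV[R]_m -> 'rV[R]_n}) x c).
apply: mulmx_inj_row => v; apply: etrans (mul_jacobian _ _ _) _.
by rewrite (diff_lin x c).
Qed.

Lemma jacobian_id (R : realType) (m : nat) (x : 'rV[R]_m) :
  jacobian id x = 1%:M.
Proof.
rewrite -(jacobian_mulmx 1%:M x).2; congr jacobian.
by apply/funext => y; rewrite mulmx1.
Qed.

#[local] Opaque jacobian.
Lemma smooth_on_continuous (R : realType) (V W : normedModType R) (U : set V)
    (f : V -> W) x : smooth_on U f -> U x -> {for x, continuous f}.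
Proof. by move=> /(_ 0%N) /= + Ux; apply. Qed.

Lemma smooth_on_differentiable (R : realType) (V W : normedModType R)
    (U : set V) (f : V -> W) x : smooth_on U f -> U x -> differentiable f x.
Proof. by move=> /(_ 1%N) /= [+ _] Ux; apply. Qed.

Lemma smooth_on_derive (R : realType) (V W : normedModType R)
    (U : set V) (f : V -> W) v : smooth_on U f -> smooth_on U ('D_v f).
Proof. by move=> sf k; have [_] := sf k.+1; apply. Qed.

Lemma chart_near (R : realType) (T : topologicalType) (m : nat)
    (c : chart R T m) (U : set T) x :
  cdom c x -> nbhs x U ->
  \forall y \near cmap c x,
    [/\ cdom c (cinv c y), U (cinv c y) & cmap c (cinv c y) = y].
Proof.
move=> cx Ux; have := cinv_continuous cx.
rewrite /prop_for /continuous_at (cmapK cx) => /(_ U Ux) cU.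
have cimy : nbhs (cmap c x) (cim c).
  by apply: open_nbhs_nbhs; split; [exact: cim_open|exists x].
apply: filterS2 cimy cU => y [x' cx' <-].
by rewrite /= (cmapK cx').
Qed.

Lemma near_cdom (R : realType) (T : topologicalType) (m : nat)
  (c : chart R T m) x : cdom c x -> nbhs x (cdom c).
Proof. by move=> cx; apply: open_nbhs_nbhs; split => //; exact: cdom_open. Qed.

(** * Differentials read in arbitrary charts *)

Section Jac.
Context {R : realType} {m : nat} {M : manifold R m}.
Implicit Types (c d e : chart R M m) (f g : M -> M).

Definition mdiff c d f x := differentiable (cmap d \o f \o cinv c) (cmap c x).

(** The common form of [chart_diff], [chart_inv_diff] and [tangent_map], which are the cases where
    one or both charts are the preferred ones; a single chain rule, [mdiff_comp], then serves all
    three. *)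
Definition jac c d f x : 'M[R]_m :=
  jacobian (cmap d \o f \o cinv c) (cmap c x).

Lemma near_comp_chart c d e f g x :
  cdom c x -> cdom d (f x) -> {for x, continuous f} ->
  \forall y \near cmap c x,
    ((cmap e \o g \o cinv d) \o (cmap d \o f \o cinv c)) y
    = (cmap e \o (g \o f) \o cinv c) y.
Proof.
move=> cx dfx cf; have := chart_near cx (cf _ (near_cdom dfx)).
by apply: filterS => y [_ /= dfy _]; rewrite (cmapK dfy).
Qed.

Lemma mdiff_comp c d e f g x :
  cdom c x -> cdom d (f x) -> {for x, continuous f} ->
  mdiff c d f x -> mdiff d e g (f x) ->
  mdiff c e (g \o f) x /\ jac c e (g \o f) x = jac c d f x *m jac d e g (f x).
Proof.
move=> cx dfx cf df dg.
have E : (cmap d \o f \o cinv c) (cmap c x) = cmap d (f x).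
  by rewrite /= (cmapK cx).
have dg' : differentiable (cmap e \o g \o cinv d)
    ((cmap d \o f \o cinv c) (cmap c x)) by rewrite E.
have H := @near_comp_chart c d e f g x cx dfx cf.
have dgf := differentiable_comp df dg'.
split; first by have [] := near_diff_eq H dgf.
by rewrite /jac (near_jacobian H dgf) (jacobian_comp df dg') E.
Qed.

Lemma chart_diffE c x : chart_diff c x = jac (chart_at x) c id x.
Proof. by []. Qed.

Lemma chart_inv_diffE c x : cdom c x ->
  chart_inv_diff c (cmap c x) = jac c (chart_at x) id x.
Proof. by move=> cx; rewrite /chart_inv_diff (cmapK cx). Qed.

Lemma tangent_mapE f x :
  tangent_map f x = jac (chart_at x) (chart_at (f x)) f x.
Proof. by []. Qed.

Lemma jacE c d f x : jac c d f x = jacobian (cmap d \o f \o cinv c) (cmap c x).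
Proof. by []. Qed.

Lemma jac_id_refl c x : cdom c x -> jac c c id x = 1%:M.
Proof.
move=> cx; rewrite /jac -[RHS](jacobian_id (cmap c x)).
have := chart_near cx (@filterT _ _ (nbhs_filter x)).
by move=> H; apply: near_jacobian => //; apply: filterS H => y [_ _ /= ->].
Qed.

#[local] Opaque jac chart_diff chart_inv_diff tangent_map.

Lemma chart_at_smooth_chart (x : M) : smooth_chart (chart_at x).
Proof. by move=> y; split; exact: chart_at_smooth. Qed.

Lemma smooth_transition_mdiff c d x : smooth_transition c d ->
  cdom c x -> cdom d x -> mdiff c d id x.
Proof. by move=> s cx dx; apply: (smooth_on_differentiable s); exists x. Qed.

Lemma jac_idK c d x : smooth_transition c d -> smooth_transition d c ->
  cdom c x -> cdom d x -> jac c d id x *m jac d c id x = 1%:M.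
Proof.
move=> cd dc cx dx.
rewrite -(jac_id_refl cx).
have [] := @mdiff_comp c d c id id x cx dx (fun _ => id).
- exact: smooth_transition_mdiff.
- exact: smooth_transition_mdiff.
by move=> _ ->.
Qed.

Lemma jac_id_chain c d (e := @chart_at _ _ M) x :
  smooth_chart c -> smooth_chart d -> cdom c x -> cdom d x ->
  mdiff c d id x /\ jac c d id x = jac c (e x) id x *m jac (e x) d id x.
Proof.
move=> sc sd cx dx.
apply: (@mdiff_comp c (e x) d id id x cx (chart_at_dom x) (fun _ => id)).
- exact: (smooth_transition_mdiff (sc x).1 cx (chart_at_dom x)).
- exact: (smooth_transition_mdiff (sd x).2 (chart_at_dom x) dx).
Qed.

Lemma chart_diffK c x : smooth_chart c -> cdom c x ->
  chart_diff c x *m chart_inv_diff c (cmap c x) = 1%:M.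
Proof.
move=> sc cx; rewrite chart_inv_diffE// chart_diffE.
exact: jac_idK (sc x).2 (sc x).1 (chart_at_dom x) cx.
Qed.

Lemma chart_inv_diffK c x : smooth_chart c -> cdom c x ->
  chart_inv_diff c (cmap c x) *m chart_diff c x = 1%:M.
Proof.
move=> sc cx; rewrite chart_inv_diffE// chart_diffE.
exact: jac_idK (sc x).1 (sc x).2 cx (chart_at_dom x).
Qed.

Lemma chart_diff_unit c x : smooth_chart c -> cdom c x ->
  chart_diff c x \in unitmx.
Proof. by move=> sc cx; exact: (mulmx1_unit (chart_diffK sc cx)).1. Qed.

Lemma chart_inv_diff_unit c x : smooth_chart c -> cdom c x ->
  chart_inv_diff c (cmap c x) \in unitmx.
Proof. by move=> sc cx; exact: (mulmx1_unit (chart_diffK sc cx)).2. Qed.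

Lemma chart_inv_diff_jac c d x : smooth_chart c -> smooth_chart d ->
  cdom c x -> cdom d x ->
  chart_inv_diff c (cmap c x) *m chart_diff d x = jac c d id x.
Proof.
move=> sc sd cx dx; have [_ ->] := jac_id_chain sc sd cx dx.
by rewrite chart_inv_diffE.
Qed.

Definition differentiable_map f := continuous f /\
  forall x y z, cdom (chart_at x) z -> cdom (chart_at y) (f z) ->
    mdiff (chart_at x) (chart_at y) f z.

(** This trades [tangent_map], whose charts vary with the point, for [jac c d f] in two fixed
    charts, where one can differentiate and pass to limits. *)
Lemma tangent_map_jac f c d x : differentiable_map f ->
  smooth_chart c -> smooth_chart d -> cdom c x -> cdom d (f x) ->
  mdiff c d f x /\
  tangent_map f x *m chart_diff d (f x) = chart_diff c x *m jac c d f x.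
Proof.
move=> [cf df] sc sd cx dfx; rewrite tangent_mapE !chart_diffE.
have xx := chart_at_dom x; have ff := chart_at_dom (f x).
have Hf := df _ _ _ xx ff.
have Hd := smooth_transition_mdiff (sd (f x)).2 ff dfx.
have [A1 B1] := @mdiff_comp _ _ d f id x xx ff (cf x) Hf Hd.
have Hc := smooth_transition_mdiff (sc x).1 cx xx.
have [A3 B3] := @mdiff_comp c _ d id f x cx xx (fun _ => id) Hc A1.
split; first exact: A3.
apply: etrans (esym B1) _.
rewrite (B3 : jac c d f x = _) mulmxA jac_idK ?mul1mx//.
- exact: (sc x).2.
- exact: (sc x).1.
Qed.

Lemma tangent_map_comp f g x : differentiable_map f -> differentiable_map g ->
  tangent_map (g \o f) x = tangent_map f x *m tangent_map g (f x).
Proof.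
move=> df dg; rewrite !tangent_mapE.
have [] // := @mdiff_comp (chart_at x) (chart_at (f x)) (chart_at (g (f x)))
  f g x (chart_at_dom _) (chart_at_dom _) (df.1 x).
  exact: df.2 (chart_at_dom _) (chart_at_dom _).
exact: dg.2 (chart_at_dom _) (chart_at_dom _).
Qed.

Lemma tangent_map_id x : tangent_map (id : M -> M) x = 1%:M.
Proof.
by rewrite tangent_mapE jac_id_refl//; exact: chart_at_dom.
Qed.

End Jac.
#[local] Opaque jac chart_diff chart_inv_diff tangent_map.

Lemma is_derive1_comp (R : realType) (V W : normedModType R) (f : R -> V)
    (g : V -> W) t v :
  is_derive t (1 : R) f v -> differentiable g (f t) ->
  is_derive t (1 : R) (g \o f) ('d g (f t) v).
Proof.
move=> [df fv] dg.
have /derivable1_diffP df' := df.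
have dgf := differentiable_comp df' dg.
split; first exact: diff_derivable.
by rewrite deriveE// diff_comp//= -fv deriveE.
Qed.

Lemma near_is_derive1 (R : realType) (V : normedModType R) (f g : R -> V) t v :
  (\forall s \near t, f s = g s) -> is_derive t (1 : R) f v ->
  is_derive t (1 : R) g v.
Proof. by move=> fg; exact: near_eq_is_derive. Qed.

Lemma is_derive1_coord (R : realType) m (f : R -> 'rV[R]_m) t v j :
  is_derive t (1 : R) f v -> is_derive t (1 : R) (fun s => f s 0 j) (v 0 j).
Proof.
move=> [df fv]; split; first by move/derivable_mxP: df; exact.
by rewrite -fv (derive_mx df) mxE.
Qed.

Lemma diff_pairl (R : realType) (V W : normedModType R) (t : V) (y : W) :
  differentiable (fun y' : W => (t, y')) y /\
  forall v, 'd (fun y' : W => (t, y')) y v = (0, v).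
Proof.
have H : is_diff y (fun y' : W => (t, y')) (fun v => (0, v)) by exact: is_diff_pair.
by case: H => H1 H2; split => // v; rewrite H2.
Qed.

Lemma diff_pairr (R : realType) (V W : normedModType R) (t : V) (y : W) :
  differentiable (fun t' : V => (t', y)) t /\
  forall v, 'd (fun t' : V => (t', y)) t v = (v, 0).
Proof.
have H : is_diff t (fun t' : V => (t', y)) (fun v => (v, 0)) by exact: is_diff_pair.
by case: H => H1 H2; split => // v; rewrite H2.
Qed.

Lemma is_derive1_0_cst (R : realType) m (f : R -> 'rV[R]_m) (a b : R) :
  a <= b -> (forall s, a <= s <= b -> is_derive s (1 : R) f 0) -> f a = f b.
Proof.
move=> ab df; apply/rowP => j.
have dfj s : a <= s <= b -> is_derive s (1 : R) (fun s => f s 0 j) 0.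
  by move=> /df /(is_derive1_coord j); rewrite mxE.
have [||c _] := @MVT_segment R (fun s => f s 0 j) (fun=> 0) a b ab.
- by move=> s sab; apply: dfj; rewrite !ltW ?(itvP sab).
- apply: derivable_within_continuous => s sab.
  by have [] := dfj s _; rewrite ?(itvP sab).
by rewrite mul0r => /eqP; rewrite subr_eq0 => /eqP.
Qed.

(** * Velocities of curves *)

Section Velocity.
Context {R : realType} {m : nat} {M : manifold R m}.
Implicit Types (c d : chart R M m) (f : M -> M) (s : R -> M).

Definition velocity s (t : R) (v : 'rV[R]_m) := {for t, continuous s} /\
  is_derive t (1 : R) (cmap (chart_at (s t)) \o s) v.

Lemma velocity_comp s (t : R) v f d : velocity s t v -> differentiable_map f ->
  smooth_chart d -> cdom d (f (s t)) ->
  is_derive t (1 : R) (cmap d \o (f \o s))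
    (v *m tangent_map f (s t) *m chart_diff d (f (s t))).
Proof.
move=> [cs ds] df sd dfs.
have xx := chart_at_dom (s t).
have [D E] := tangent_map_jac df (chart_at_smooth_chart (s t)) sd xx dfs.
rewrite -mulmxA.
rewrite E.
rewrite chart_diffE.
rewrite (jac_id_refl xx).
rewrite mul1mx.
have := is_derive1_comp ds D; rewrite -mul_jacobian.
apply: near_is_derive1.
have cs' : \forall s' \near t, cdom (chart_at (s t)) (s s').
  exact: cs _ (near_cdom xx).
apply: filterS cs' => s' /= H.
by rewrite (cmapK H).
Qed.

Lemma differentiable_map_id : differentiable_map (id : M -> M).
Proof.
split=> [x U //|x y z xz yz].
exact: smooth_transition_mdiff (chart_at_smooth x y) xz yz.
Qed.

Lemma velocity_chart s (t : R) v d : velocity s t v ->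
  smooth_chart d -> cdom d (s t) ->
  is_derive t (1 : R) (cmap d \o s) (v *m chart_diff d (s t)).
Proof.
move=> vs sd ds.
have := velocity_comp vs differentiable_map_id sd ds.
by rewrite tangent_map_id mulmx1.
Qed.

Lemma velocity_map s (t : R) v f : velocity s t v -> differentiable_map f ->
  velocity (f \o s) t (v *m tangent_map f (s t)).
Proof.
move=> vs df; split; first by apply: continuous_comp; [exact: vs.1|exact: df.1].
have := velocity_comp vs df (chart_at_smooth_chart (f (s t))) (chart_at_dom _).
by rewrite chart_diffE (jac_id_refl (chart_at_dom _)) mulmx1.
Qed.

Lemma velocity_unique s (t : R) v v' : velocity s t v -> velocity s t v' -> v = v'.
Proof. by move=> [_ [_ <-]] [_ [_ <-]]. Qed.

(** The mean value theorem in a chart makes the curve locally constant; the times at which it equals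
    [s 0] then form an open and closed subset of the connected line. *)
Lemma velocity0_cst s : (forall t, velocity s t 0) -> forall t, s t = s 0.
Proof.
move=> vs.
have loc t0 : \forall t \near t0, s t = s t0.
  have xx := chart_at_dom (s t0); set d := chart_at (s t0) in xx.
  have : \forall t \near t0, cdom d (s t) by exact: (vs t0).1 _ (near_cdom xx).
  move=> /nbhs_ballP[e /= e0 eP].
  have dd t : ball t0 e t -> is_derive t (1 : R) (cmap d \o s) 0.
    move=> /eP dt.
    by have := velocity_chart (vs t) (chart_at_smooth_chart _) dt; rewrite mul0mx.
  apply/nbhs_ballP; exists e => //= t tb.
  suff : cmap d (s t0) = cmap d (s t).
    by move=> E; rewrite -(cmapK xx) -[LHS](cmapK (eP _ tb)) E.
  have [le|/ltW le] := leP t0 t.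
    apply: (@is_derive1_0_cst _ _ (cmap d \o s) _ _ le) => r /andP[r1 r2];
      apply: dd.
    move: tb; rewrite /ball/= !ltr_distlC; lra.
  apply/esym; apply: (@is_derive1_0_cst _ _ (cmap d \o s) _ _ le) => r /andP[r1 r2];
      apply: dd.
  move: tb; rewrite /ball/= !ltr_distlC; lra.
have cR : connected [set: R] by apply/connected_intervalP.
have E0 : [set t | s t = s 0] = [set: R].
  apply: cR; first by exists 0.
  - exists [set t | s t = s 0]; last by rewrite setTI.
    rewrite openE => r /= sr.
    by apply: filterS (loc r) => r' /= ->.
  - exists [set t | s t = s 0]; last by rewrite setTI.
    rewrite -[X in closed X]setCK; apply: open_closedC.
    rewrite openE => r /= sr.
    by apply: filterS (loc r) => r' /= ->.
by move=> t; have : [set: R] t by []; rewrite -E0.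
Qed.

End Velocity.

(** * Smooth actions and flows *)

Lemma velocity_shift (R : realType) (m : nat) (M : manifold R m) (s : R -> M)
    (k t : R) v :
  velocity s (t + k) v -> velocity (fun r => s (r + k)) t v.
Proof.
move=> [cs ds]; split.
  have C : {for t, continuous (fun r : R => r + k)}.
    by apply: cvgD; [exact: cvg_id|exact: cvg_cst].
  exact: (@continuous_comp R R M (fun r => r + k) s t C).
have [ds1 <-] := ds.
have dk : is_derive t (1 : R) (fun r => r + k) 1.
  have := is_deriveD (is_derive_id t (1 : R)) (is_derive_cst k t (1 : R)).
  by rewrite addr0.
have /derivable1_diffP ds2 := ds1.
by have := is_derive1_comp dk ds2; rewrite -deriveE.
Qed.

Section Raction.
Context {R : realType} {m : nat} {M : manifold R m}.
Variable a : R -> M -> M.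
Hypothesis a_act : smooth_Raction a.

Definition act_in (c d : chart R M m) (ty : R * 'rV[R]_m) : 'rV[R]_m :=
  cmap d (a ty.1 (cinv c ty.2)).

Lemma act_cvg (T : Type) (F : set_system T) (FF : Filter F) (f : T -> R)
    (h : T -> M) t x :
  f r @[r --> F] --> t -> h r @[r --> F] --> x -> a (f r) (h r) @[r --> F] --> a t x.
Proof.
move=> ft hx.
have := @ract_continuous _ _ _ _ a_act (t, x).
by move=> /(cvg_comp _ _ (cvg_pair ft hx)).
Qed.

Lemma act_continuous t : continuous (a t).
Proof. by move=> x; apply: act_cvg; [exact: cvg_cst|exact: cvg_id]. Qed.

Lemma act_in_differentiable x y t z :
  cdom (chart_at x) z -> cdom (chart_at y) (a t z) ->
  differentiable (act_in (chart_at x) (chart_at y)) (t, cmap (chart_at x) z).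
Proof.
move=> xz yz; apply: (smooth_on_differentiable (ract_smooth a_act x y)).
by rewrite /= (cmapK xz); split => //; exists z.
Qed.

Lemma act_diff x y t z :
  cdom (chart_at x) z -> cdom (chart_at y) (a t z) ->
  mdiff (chart_at x) (chart_at y) (a t) z /\
  forall v, v *m jac (chart_at x) (chart_at y) (a t) z =
    'd (act_in (chart_at x) (chart_at y)) (t, cmap (chart_at x) z) (0, v).
Proof.
move=> xz yz; have D := act_in_differentiable xz yz.
have [D2 E2] := diff_pairl t (cmap (chart_at x) z).
split; first exact: differentiable_comp D2 D.
move=> v; rewrite -E2 jacE; apply: etrans (mul_jacobian _ _ _) _.
by rewrite (diff_comp D2 D).
Qed.

Lemma act_differentiable t : differentiable_map (a t).
Proof.
by split; [exact: act_continuous|move=> x y z xz yz; exact: (act_diff xz yz).1].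
Qed.

Lemma act_velocity x t : velocity (a^~ x) t (generator a (a t x)).
Proof.
have orb y : velocity (a^~ y) 0 (generator a y).
  split; first by apply: act_cvg; [exact: cvg_id|exact: cvg_cst].
  rewrite /generator (ract0 a_act).
  have yy := chart_at_dom y.
  have ay : cdom (chart_at y) (a 0 y) by rewrite (ract0 a_act).
  have D := act_in_differentiable yy ay.
  have D1 : differentiable (fun t : R => (t, cmap (chart_at y) y)) (0 : R).
    exact: differentiable_pair.
  have := differentiable_comp D1 D.
  move=> /derivable1_diffP/derivableP.
  have -> // : act_in (chart_at y) (chart_at y) \o (fun t => (t, cmap (chart_at y) y))
     = cmap (chart_at y) \o (a^~ y).
  by apply/funext => r; rewrite /act_in /= (cmapK yy).
have := orb (a t x); rewrite -{1}(subrr t) => /velocity_shift.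
suff -> : a^~ x = (fun r => a (r - t) (a t x)) by [].
by apply/funext => r; rewrite -(ractD a_act) subrK.
Qed.

(** R is commutative: the orbit curve of [a t x] is the image under [a t] of the orbit curve of [x],
    and a curve has one velocity. *)
Lemma generator_invariant t x :
  generator a x *m tangent_map (a t) x = generator a (a t x).
Proof.
have v0 := act_velocity x 0; rewrite (ract0 a_act) in v0.
have := velocity_map v0 (act_differentiable t).
rewrite (ract0 a_act) => v1.
have v2 := act_velocity (a t x) 0; rewrite (ract0 a_act) in v2.
apply: velocity_unique v2.
suff -> : a^~ (a t x) = a t \o a^~ x by [].
by apply/funext => r /=; rewrite -!(ractD a_act) addrC.
Qed.

Lemma tangent_actK t x :
  tangent_map (a t) x *m tangent_map (a (- t)) (a t x) = 1%:M.
Proof.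
rewrite -tangent_map_comp; try exact: act_differentiable.
rewrite -[RHS](tangent_map_id x); congr (tangent_map _ x).
by apply/funext => y /=; rewrite -(ractD a_act) addNr (ract0 a_act).
Qed.

(** Joint smoothness in time and point is used here: the entries are partial derivatives of
    [act_in], hence continuous in both variables together. *)
Lemma jac_act_cvg x y t z :
  cdom (chart_at x) z -> cdom (chart_at y) (a t z) ->
  jac (chart_at x) (chart_at y) (a p.1) p.2 @[p --> (t, z)] -->
  jac (chart_at x) (chart_at y) (a t) z.
Proof.
move=> xz yz.
have near_z : \forall p \near (t, z),
    cdom (chart_at x) p.2 /\ cdom (chart_at y) (a p.1 p.2).
  have H1 : \forall p \near (t, z), cdom (chart_at x) p.2.
    exact: (@cvg_snd _ _ (nbhs t) (nbhs z)) _ (near_cdom xz).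
  have H2 : \forall p \near (t, z), cdom (chart_at y) (a p.1 p.2).
    exact: (@ract_continuous _ _ _ _ a_act (t, z)) _ (near_cdom yz).
  by apply: filterS2 H1 H2.
apply/cvg_mxP => i j.
have E t' z' : cdom (chart_at x) z' -> cdom (chart_at y) (a t' z') ->
    jac (chart_at x) (chart_at y) (a t') z' i j =
    ('D_(0, delta_mx 0 i) (act_in (chart_at x) (chart_at y))
      (t', cmap (chart_at x) z')) 0 j.
  move=> xz' yz'; rewrite deriveE; last exact: act_in_differentiable.
  rewrite -(act_diff xz' yz').2. by rewrite -rowE [RHS]mxE.
rewrite [X in _ --> X](E _ _ xz yz).
have := smooth_on_continuous (smooth_on_derive (0, delta_mx 0 i)
  (ract_smooth a_act x y)) (x := (t, cmap (chart_at x) z)) _.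
move=> C.
have {}C : {for (t, cmap (chart_at x) z), continuous
    ('D_(0, delta_mx 0 i) (act_in (chart_at x) (chart_at y)))}.
  by apply: C; rewrite /= (cmapK xz); split => //; exists z.
have C2 : (p.1, cmap (chart_at x) p.2) @[p --> (t, z)] --> (t, cmap (chart_at x) z).
  have C1 : cmap (chart_at x) p.2 @[p --> (t, z)] --> cmap (chart_at x) z.
    apply: (@cvg_comp _ _ _ snd (cmap (chart_at x)) _ (nbhs z)).
      exact: cvg_snd.
    exact: cmap_continuous xz.
  exact: cvg_pair cvg_fst C1.
have C3 := cvg_comp _ _ C2 C.
have := cvg_comp _ _ C3 (@coord_continuous _ _ _ 0 j _).
apply: cvg_trans; apply: near_eq_cvg.
by apply: filterS near_z => -[t' z'] /= [xz' yz']; rewrite (E _ _ xz' yz').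
Qed.

End Raction.

Section Flow.
Context {R : realType} {m : nat} {M : manifold R m}.
Variables (g : R -> M -> M) (X : M -> 'rV[R]_m).
Hypothesis g_flow : is_flow g X.

(** Uniqueness of integral curves follows from the existence of the flow: the curve g_(-t)(s(t)) has
    velocity zero, because a flow preserves its own vector field. *)
Lemma flow_unique (s : R -> M) :
  (forall t, velocity s t (X (s t))) -> forall t, s t = g t (s 0).
Proof.
have [ag gX] := g_flow.
move=> vs.
suff H : forall t, g (- t) (s t) = s 0.
  by move=> t; rewrite -(H t) -(ractD ag) subrr (ract0 ag).
suff V : forall t, velocity (fun t => g (- t) (s t)) t 0.
  by move=> t; rewrite (velocity0_cst V) oppr0 (ract0 ag).
move=> t; split.
  apply: (act_cvg ag); last exact: (vs t).1.
  exact: continuousN.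
set y := g (- t) (s t).
have xx := chart_at_dom (s t); have yy := chart_at_dom y.
have D := act_in_differentiable ag xx yy.
have DD : is_derive t (1 : R) (fun r => (- r, cmap (chart_at (s t)) (s r)))
    (-1, X (s t)).
  have [_ [d1 <-]] := vs t.
  have dN : is_derive t (1 : R) -%R (-1 : R) by exact: is_deriveN.
  have /derivable1_diffP d1' := d1.
  have /derivable1_diffP d2' := @ex_derive _ _ _ _ _ _ _ dN.
  have dp := differentiable_pair d2' d1'.
  split; first exact: diff_derivable.
  by rewrite deriveE// diff_pair// -!deriveE// (@derive_val _ _ _ _ _ _ _ dN).
have := is_derive1_comp DD D.
(* The time direction contributes minus the field at [y], the space direction the push-forward of
   the field at [s t]; by [generator_invariant] these cancel. *)
have -> : 'd (act_in g (chart_at (s t)) (chart_at y))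
    (- t, cmap (chart_at (s t)) (s t)) (-1, X (s t)) = 0.
  have -> : ((-1, X (s t)) : R * 'rV[R]_m) = - (1, 0) + (0, X (s t)).
     by apply: injective_projections => /=; rewrite ?oppr0 ?addr0 ?add0r.
  rewrite linearD linearN.
  rewrite -(act_diff ag xx yy).2.
  have [_ TE] := tangent_map_jac (act_differentiable ag (- t))
    (chart_at_smooth_chart (s t)) (chart_at_smooth_chart y) xx yy.
  have := velocity_chart (act_velocity ag (s t) (- t)) (chart_at_smooth_chart y) yy.
  have D1 : is_derive (- t) (1 : R)
      (fun r : R => (r, cmap (chart_at (s t)) (s t))) (1, 0).
    have [d1 d2] := diff_pairr (- t) (cmap (chart_at (s t)) (s t)).
    split; first exact: diff_derivable.
    by rewrite deriveE.
  have := is_derive1_comp D1 D.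
  have -> : act_in g (chart_at (s t)) (chart_at y) \o
      (fun r => (r, cmap (chart_at (s t)) (s t))) = cmap (chart_at y) \o g^~ (s t).
    by apply/funext => r; rewrite /act_in /= (cmapK xx).
  move=> [_ <-] [_ ->].
  rewrite -(generator_invariant ag) -mulmxA TE chart_diffE (jac_id_refl xx).
  by rewrite mul1mx gX addNr.
apply: near_is_derive1.
have cs : \forall r \near t, cdom (chart_at (s t)) (s r).
  exact: (vs t).1 _ (near_cdom xx).
by apply: filterS cs => r xr; rewrite /act_in /= (cmapK xr).
Qed.

End Flow.

(** * Gram-Schmidt *)

Section GramSchmidt.
Context {R : realType} {m n : nat}.
Notation V := 'rV[R]_m.
Variables (j : V -> V) (g : V -> V -> R).
Hypothesis j_lin : linear j.
Hypothesis jj : forall v, j (j v) = - v.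
Hypothesis gl : forall a u v x, g (a *: u + v) x = a * g u x + g v x.
Hypothesis gC : forall u v, g u v = g v u.
Hypothesis gj : forall u v, g (j u) (j v) = g u v.
Hypothesis g_pos : forall v, v != 0 -> 0 < g v v.
Implicit Types (u v : V) (e : 'I_n -> V).

(** The hermitian projection of [v] to the complex line of [u], multiplied by [g u u]. *)
Definition hproj u v := g v u *: u + g v (j u) *: j u.

(** Earlier vectors are treated like later ones: being already orthogonal to [e k], they do not
    change, and the step remains one uniform formula. *)
Definition gs_step (k : 'I_n) e (l : 'I_n) : V :=
  if l == k then (Num.sqrt (g (e k) (e k)))^-1 *: e k
  else e l - (g (e k) (e k))^-1 *: hproj (e k) (e l).

(* complex multiplication by c + i s, [j] standing for i *)
Definition cscale (c s : R) v := c *: v + s *: j v.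

Lemma jD u v : j (u + v) = j u + j v.
Proof. by have := j_lin 1 u v; rewrite !scale1r. Qed.

Lemma j0 : j 0 = 0.
Proof. by apply: (addrI (j 0)); rewrite -jD !addr0. Qed.

Lemma jZ a v : j (a *: v) = a *: j v.
Proof. by have := j_lin a v 0; rewrite j0 !addr0. Qed.

Lemma jN v : j (- v) = - j v.
Proof. by rewrite -scaleN1r jZ scaleN1r. Qed.

Lemma g0l v : g 0 v = 0.
Proof.
by apply: (addrI (g 0 v)); rewrite addr0 -{3}(addr0 0) -{3}(scale1r 0) gl mul1r.
Qed.

Lemma gDl u v x : g (u + v) x = g u x + g v x.
Proof. by rewrite -{1}(scale1r u) gl mul1r. Qed.

Lemma gZl a v x : g (a *: v) x = a * g v x.
Proof. by rewrite -[a *: v]addr0 gl g0l addr0. Qed.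

Lemma gDr u v x : g x (u + v) = g x u + g x v.
Proof. by rewrite gC gDl !(gC x). Qed.

Lemma gZr a v x : g x (a *: v) = a * g x v.
Proof. by rewrite gC gZl (gC x). Qed.

Lemma gNl v x : g (- v) x = - g v x.
Proof. by rewrite -scaleN1r gZl mulN1r. Qed.

Lemma gNr v x : g x (- v) = - g x v.
Proof. by rewrite gC gNl (gC x). Qed.

Lemma gjl u v : g (j u) v = - g u (j v).
Proof. by rewrite -gj jj gNl. Qed.

Lemma gjv v : g v (j v) = 0.
Proof. by have := gjl v v; rewrite gC; lra. Qed.

Let gE := (gDl, gZl, gNl, gDr, gZr, gNr, gjl, jD, jZ, jN, jj, gjv).

Lemma hproj_cscale c s u v : c ^+ 2 + s ^+ 2 = 1 ->
  hproj (cscale c s u) v = hproj u v.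
Proof.
move=> cs; rewrite /hproj /cscale !gE.
apply/rowP => i; rewrite !mxE; set X := g v u; set Y := g v (j u).
by rewrite -[RHS]mul1r -cs; ring.
Qed.

Lemma hproj_cscaler c s u v :
  hproj u (cscale c s v) = cscale c s (hproj u v).
Proof.
rewrite /hproj /cscale !gE.
by apply/rowP => i; rewrite !mxE; ring.
Qed.

Lemma g_cscale c s u : c ^+ 2 + s ^+ 2 = 1 ->
  g (cscale c s u) (cscale c s u) = g u u.
Proof.
by move=> cs; rewrite /cscale !gE -[RHS]mul1r -cs; ring.
Qed.

(** Each vector may carry its own phase, since unit phases cancel in norms and in the first argument
    of [hproj] and pass through the second. This is equivariance under diagonal unitary matrices. *)
Lemma gs_step_cscale k e (c s : 'I_n -> R) :
  (forall l, c l ^+ 2 + s l ^+ 2 = 1) ->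
  gs_step k (fun l => cscale (c l) (s l) (e l)) =
  (fun l => cscale (c l) (s l) (gs_step k e l)).
Proof.
move=> cs; apply/funext => l; rewrite /gs_step g_cscale//.
have [->|lk] := eqVneq l k.
  by rewrite /cscale !gE; apply/rowP => i; rewrite !mxE; ring.
rewrite hproj_cscale// hproj_cscaler /cscale !gE.
by apply/rowP => i; rewrite !mxE; ring.
Qed.

(** The index [l] is not bounded by [K]: the first [K] vectors are also orthogonal to all later
    ones, so the next step leaves them alone. *)
Definition orthonormal_upto (K : nat) e := forall i l : 'I_n, (i < K)%N ->
  g (e i) (e l) = (i == l)%:R /\ g (e i) (j (e l)) = 0.

Lemma hproj_g u v : u != 0 ->
  g u (v - (g u u)^-1 *: hproj u v) = 0 /\ g u (j (v - (g u u)^-1 *: hproj u v)) = 0.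
Proof.
move=> u0; have gu : g u u != 0 by rewrite gt_eqF// g_pos.
rewrite /hproj !gE !(gC v) !gE; split; first by field.
by field.
Qed.

Lemma gs_step_orthonormal (k : 'I_n) e : e k != 0 ->
  orthonormal_upto k e -> orthonormal_upto k.+1 (gs_step k e).
Proof.
move=> ek0 oe i l; rewrite ltnS => ik.
have gk : 0 < g (e k) (e k) by exact: g_pos.
have gk0 : g (e k) (e k) != 0 by rewrite gt_eqF.
have sk0 : Num.sqrt (g (e k) (e k)) != 0 by rewrite gt_eqF// sqrtr_gt0.
have skk := sqr_sqrtr (ltW gk).
have aux (S G : R) : S != 0 -> S ^+ 2 = G -> S^-1 * (S^-1 * G) = 1.
  by move=> S0 <-; field.
have [eik|nik] := eqVneq i k.
  rewrite eik /gs_step eqxx; case: (eqVneq l k) => [lk|nlk].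
    rewrite !gE; split; last by ring.
    by apply: (aux _ _ sk0 skk).
  rewrite !gZl.
  by have [-> ->] := hproj_g (e l) ek0; rewrite mulr0.
have {}ik : (i < k)%N by rewrite ltn_neqAle ik andbT.
have [gik1 gik2] := oe i k ik.
have ei : gs_step k e i = e i.
  rewrite /gs_step (negPf nik) /hproj gik1 gik2 (negPf nik).
  by rewrite !scale0r addr0 scaler0 subr0.
rewrite ei /gs_step; case: (eqVneq l k) => [->|nlk].
  by rewrite !gE gik1 gik2 (negPf nik) !mulr0.
have [gil1 gil2] := oe i l ik.
rewrite /hproj !gE gik1 gik2 gil1 gil2 (negPf nik) mulr0n; split; ring.
Qed.

(** The step is undone: the old vectors lie in the complex span of the new ones, so that a frame
    stays invertible. *)
Lemma gs_step_span (k : 'I_n) e l : e k != 0 ->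
  exists a b : R, exists2 c : R, c != 0 & e l = c *: gs_step k e l +
    (if l == k then 0 else a *: gs_step k e k + b *: j (gs_step k e k)).
Proof.
move=> ek0.
have gk : 0 < g (e k) (e k) by exact: g_pos.
have sk0 : Num.sqrt (g (e k) (e k)) != 0 by rewrite gt_eqF// sqrtr_gt0.
rewrite /gs_step eqxx; case: (eqVneq l k) => [->|nlk].
  exists 0, 0, (Num.sqrt (g (e k) (e k))) => //.
  by rewrite scalerA divff// scale1r addr0.
set s := Num.sqrt _ in sk0 *.
exists ((g (e k) (e k))^-1 * g (e l) (e k) * s),
  ((g (e k) (e k))^-1 * g (e l) (j (e k)) * s), 1 => //.
rewrite jZ /hproj; apply/rowP => i; rewrite !mxE.
by field; rewrite sk0 gt_eqF.
Qed.

End GramSchmidt.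

(** * Vector fields along a map *)

Lemma near_eq_cvgl (T : Type) (U : topologicalType) (F : set_system T)
    (FF : Filter F) (f g : T -> U) (l l' : U) :
  g r @[r --> F] --> l' -> l = l' -> (\forall r \near F, f r = g r) ->
  f r @[r --> F] --> l.
Proof.
move=> gl -> fg; apply: cvg_trans gl; apply: near_eq_cvg.
by apply: filterS fg => r ->.
Qed.

Section FieldsAlong.
Context {R : realType} {m : nat} {M : manifold R m}.

(* [X] is a family of [k] vector fields along [v]; convergence is tested in
   the charts, since the coordinates of T_(v r) M jump with [r]. *)
Definition cvg_along (T : Type) (F : set_system T) (k : nat) (v : T -> M)
    (X : T -> 'M[R]_(k, m)) (q : T) :=
  forall x, cdom (chart_at x) (v q) ->
    X r *m chart_diff (chart_at x) (v r) @[r --> F] -->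
    X q *m chart_diff (chart_at x) (v q).

Context {T : Type} {F : set_system T} {FF : Filter F}.
Variables (v : T -> M) (q : T).
Hypothesis v_cvg : v r @[r --> F] --> v q.

Lemma near_along (U : set M) : nbhs (v q) U -> \forall r \near F, U (v r).
Proof. by move=> Uq; exact: v_cvg _ Uq. Qed.

Lemma cvg_along_act (a : R -> M -> M) (t : R) k (X : T -> 'M[R]_(k, m)) :
  smooth_Raction a -> cvg_along F v X q ->
  cvg_along F (a t \o v) (fun r => X r *m tangent_map (a t) (v r)) q.
Proof.
move=> sa Xq x /= xq.
have cc := chart_at_dom (v q); set c := chart_at (v q) in cc.
have E z : cdom c z -> cdom (chart_at x) (a t z) ->
    tangent_map (a t) z *m chart_diff (chart_at x) (a t z) =
    chart_diff c z *m jac c (chart_at x) (a t) z.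
  move=> cz xz.
  exact: (tangent_map_jac (act_differentiable sa t) (chart_at_smooth_chart _)
    (chart_at_smooth_chart _) cz xz).2.
have H1 := near_along (near_cdom cc).
have H2 : \forall r \near F, cdom (chart_at x) (a t (v r)).
  have atv : a t (v r) @[r --> F] --> a t (v q).
    by apply: (act_cvg sa) => //; exact: cvg_cst.
  exact: atv _ (near_cdom xq).
have J : jac c (chart_at x) (a t) (v r) @[r --> F] -->
         jac c (chart_at x) (a t) (v q).
  have P : (t, v r) @[r --> F] --> (t, v q).
    exact: cvg_pair (cvg_cst t) v_cvg.
  exact: cvg_comp _ _ P (jac_act_cvg sa cc xq).
apply: (near_eq_cvgl _ (cvg_mulmx _ (Xq _ cc) J)).
  by rewrite -[LHS]mulmxA [X in _ *m X](E _ cc xq) mulmxA.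
apply: filterS2 H1 H2 => r c1 c2.
by rewrite -[LHS]mulmxA [X in _ *m X](E _ c1 c2) mulmxA.
Qed.

Lemma endo_inE c (J : M -> 'M[R]_m) z : smooth_chart c -> cdom c z ->
  J z *m chart_diff c z = chart_diff c z *m endo_in c J (cmap c z).
Proof.
move=> sc cz; rewrite /endo_in (cmapK cz) !mulmxA.
by rewrite (chart_diffK sc cz) mul1mx.
Qed.

Lemma cvg_along_endo (J : M -> 'M[R]_m) k (X : T -> 'M[R]_(k, m)) :
  (forall x : M, smooth_on (cim (chart_at x)) (endo_in (chart_at x) J)) ->
  cvg_along F v X q ->
  cvg_along F v (fun r => X r *m J (v r)) q.
Proof.
move=> sJ Xq x xq.
have E z : cdom (chart_at x) z -> J z *m chart_diff (chart_at x) z =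
    chart_diff (chart_at x) z *m endo_in (chart_at x) J (cmap (chart_at x) z).
  by move=> xz; apply: endo_inE xz; exact: chart_at_smooth_chart.
have H1 := near_along (near_cdom xq).
have C1 : cmap (chart_at x) (v r) @[r --> F] --> cmap (chart_at x) (v q).
  exact: cvg_comp _ _ v_cvg (cmap_continuous xq).
have C2 : {for cmap (chart_at x) (v q), continuous (endo_in (chart_at x) J)}.
  by apply: (smooth_on_continuous (sJ x)); exists (v q).
apply: (near_eq_cvgl _ (cvg_mulmx _ (Xq _ xq) (cvg_comp _ _ C1 C2))).
  by rewrite -[LHS]mulmxA [X in _ *m X](E _ xq) mulmxA.
apply: filterS H1 => r c1.
by rewrite -[LHS]mulmxA [X in _ *m X](E _ c1) mulmxA.
Qed.

Lemma form_inE c (w : M -> 'M[R]_m) z : smooth_chart c -> cdom c z ->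
  w z = chart_diff c z *m form_in c w (cmap c z) *m (chart_diff c z)^T.
Proof.
move=> sc cz; rewrite /form_in (cmapK cz) !mulmxA.
rewrite (chart_diffK sc cz) mul1mx -mulmxA -trmx_mul (chart_diffK sc cz).
by rewrite trmx1 mulmx1.
Qed.

Lemma mulmx_conj k l (A : 'M[R]_(k, m)) (B : 'M[R]_(l, m)) (D W : 'M[R]_m) :
  A *m (D *m W *m D^T) *m B^T = A *m D *m W *m (D^T *m B^T).
Proof. by rewrite !mulmxA. Qed.

Lemma cvg_form (w : M -> 'M[R]_m) k l (X : T -> 'M[R]_(k, m))
    (Y : T -> 'M[R]_(l, m)) :
  (forall x : M, smooth_on (cim (chart_at x)) (form_in (chart_at x) w)) ->
  cvg_along F v X q -> cvg_along F v Y q ->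
  X r *m w (v r) *m (Y r)^T @[r --> F] --> X q *m w (v q) *m (Y q)^T.
Proof.
move=> sw Xq Yq.
have cc := chart_at_dom (v q); set c := chart_at (v q) in cc.
have E z (A : 'M[R]_(k, m)) (B : 'M[R]_(l, m)) : cdom c z ->
    A *m w z *m B^T = (A *m chart_diff c z) *m form_in c w (cmap c z) *m
      (B *m chart_diff c z)^T.
  move=> cz; rewrite [X in _ = _ *m X]trmx_mul.
  rewrite {1}(form_inE w (chart_at_smooth_chart _) cz).
  exact: mulmx_conj.
have C1 : cmap c (v r) @[r --> F] --> cmap c (v q).
  exact: cvg_comp _ _ v_cvg (cmap_continuous cc).
have C2 : {for cmap c (v q), continuous (form_in c w)}.
  by apply: (smooth_on_continuous (sw _)); exists (v q).
apply: (near_eq_cvgl _ (cvg_mulmx _ (cvg_mulmx _ (Xq _ cc)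
  (cvg_comp _ _ C1 C2)) (cvg_trmx _ (Yq _ cc))) (E _ _ _ cc)).
by apply: filterS (near_along (near_cdom cc)) => r c1; rewrite (E _ _ _ c1).
Qed.

Lemma cvg_ev (w : M -> 'M[R]_m) (X Y : T -> 'rV[R]_m) :
  (forall x : M, smooth_on (cim (chart_at x)) (form_in (chart_at x) w)) ->
  cvg_along F v X q -> cvg_along F v Y q ->
  ev w (v r) (X r) (Y r) @[r --> F] --> ev w (v q) (X q) (Y q).
Proof.
move=> sw Xq Yq.
exact: ((cvg_mxP FF (fun r => X r *m w (v r) *m (Y r)^T) _).1
  (cvg_form sw Xq Yq) 0 0).
Qed.

Lemma cvg_along_mull k l (A : T -> 'M[R]_(l, k)) (X : T -> 'M[R]_(k, m)) :
  A r @[r --> F] --> A q -> cvg_along F v X q ->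
  cvg_along F v (fun r => A r *m X r) q.
Proof.
move=> Aq Xq x xq.
apply: (near_eq_cvgl _ (cvg_mulmx _ Aq (Xq _ xq))); first by rewrite mulmxA.
by apply: nearW => r; rewrite mulmxA.
Qed.

Lemma cvg_along_mulc k l (A : 'M[R]_(l, k)) (X : T -> 'M[R]_(k, m)) :
  cvg_along F v X q -> cvg_along F v (fun r => A *m X r) q.
Proof. by move=> Xq; apply: (@cvg_along_mull _ _ (fun=> A)) => //; exact: cvg_cst. Qed.

Lemma cvg_alongD k (X Y : T -> 'M[R]_(k, m)) :
  cvg_along F v X q -> cvg_along F v Y q ->
  cvg_along F v (fun r => X r + Y r) q.
Proof.
move=> Xq Yq x xq.
apply: (near_eq_cvgl _ (cvgD (Xq _ xq) (Yq _ xq))); first by rewrite mulmxDl.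
by apply: nearW => r; rewrite mulmxDl.
Qed.

Lemma cvg_alongZ k (b : T -> R) (X : T -> 'M[R]_(k, m)) :
  b r @[r --> F] --> b q -> cvg_along F v X q ->
  cvg_along F v (fun r => b r *: X r) q.
Proof.
move=> bq Xq x xq.
apply: (near_eq_cvgl _ (cvgZ bq (Xq _ xq))); first by rewrite scalemxAl.
by apply: nearW => r; rewrite scalemxAl.
Qed.

Lemma cvg_along_rows k (X : T -> 'M[R]_(k, m)) :
  (forall i, cvg_along F v (fun r => row i (X r)) q) -> cvg_along F v X q.
Proof.
move=> Xq x xq; apply/cvg_mxP => i j.
have /cvg_mxP/(_ 0 j) := Xq i x xq.
move=> /(near_eq_cvgl _); apply; first by rewrite -row_mul [RHS]mxE.
by apply: nearW => r; rewrite -row_mul [RHS]mxE.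
Qed.

Lemma cvg_along_row k (X : T -> 'M[R]_(k, m)) i :
  cvg_along F v X q -> cvg_along F v (fun r => row i (X r)) q.
Proof.
move=> Xq x xq; have H := @cvg_row _ _ _ _ _ FF _ _ i (Xq x xq).
apply: (near_eq_cvgl _ H); first by rewrite row_mul.
by apply: nearW => r; rewrite row_mul.
Qed.

Lemma smooth_on_jacobian k (U : set 'rV[R]_m) (f : 'rV[R]_m -> 'rV[R]_k) y :
  smooth_on U f -> nbhs y U -> {for y, continuous (jacobian f)}.
Proof.
move=> sf Uy; apply/(cvg_mxP (nbhs_filter y)) => i j.
have E z : U z -> jacobian f z i j = ('D_(delta_mx 0 i) f z) 0 j.
  move=> Uz; rewrite deriveE; last exact: smooth_on_differentiable sf Uz.
  by rewrite -mul_jacobian -rowE [RHS]mxE.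
have C := smooth_on_continuous (smooth_on_derive (delta_mx 0 i) sf)
  (nbhs_singleton Uy).
have H : ('D_(delta_mx 0 i) f z) 0 j @[z --> y] --> ('D_(delta_mx 0 i) f y) 0 j.
  have C' : 'D_(delta_mx 0 i) f z @[z --> y] --> 'D_(delta_mx 0 i) f y by exact: C.
  exact: ((cvg_mxP (nbhs_filter y) _ _).1 C' 0 j).
apply: (near_eq_cvgl (nbhs_filter y) H (E _ (nbhs_singleton Uy))).
by apply: filterS Uy => z Uz; rewrite (E _ Uz).
Qed.

Lemma cvg_along_chart (f : chart R M m) : smooth_chart f -> cdom f (v q) ->
  cvg_along F v (fun r => chart_inv_diff f (cmap f (v r))) q.
Proof.
move=> sf fq x xq.
have E z : cdom f z -> cdom (chart_at x) z ->
    chart_inv_diff f (cmap f z) *m chart_diff (chart_at x) z =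
    jacobian (cmap (chart_at x) \o cinv f) (cmap f z).
  move=> fz xz; rewrite (chart_inv_diff_jac sf (chart_at_smooth_chart _) fz xz).
  exact: jacE.
have C1 : cmap f (v r) @[r --> F] --> cmap f (v q).
  exact: cvg_comp _ _ v_cvg (cmap_continuous fq).
have U : nbhs (cmap f (v q)) (cmap f @` (cdom f `&` cdom (chart_at x))).
  apply: filterS (chart_near fq (near_cdom xq)) => y [fy xy yE].
  by exists (cinv f y).
have C2 := smooth_on_jacobian (sf x).1 U.
apply: (near_eq_cvgl _ (cvg_comp _ _ C1 C2) (E _ fq xq)).
apply: filterS2 (near_along (near_cdom fq)) (near_along (near_cdom xq)).
by move=> r fr xr; rewrite (E _ fr xr).
Qed.

End FieldsAlong.

(** * The disc *)

Section Polar.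
Context {R : realType}.
Implicit Types (q : R * R) (s t : R).

(** The point e^(-(s + i t)); turning it counterclockwise lowers [t], as [rot_polar] records. *)
Definition polar s t : R * R := (expR (- s) * cos (- t), expR (- s) * sin (- t)).

Definition rot t q : R * R :=
  (cos t * q.1 - sin t * q.2, sin t * q.1 + cos t * q.2).

Definition scaleq k q : R * R := (k * q.1, k * q.2).

Lemma ex_angle (x y : R) : x ^+ 2 + y ^+ 2 = 1 ->
  exists t, cos t = x /\ sin t = y.
Proof.
move=> xy1.
have x1 : -1 <= x <= 1.
  rewrite -ler_norml -(@ler_pXn2r _ 2) ?nnegrE// real_normK ?num_real// expr1n.
  by have := sqr_ge0 y; lra.
have ca : cos (acos x) = x by rewrite acosK// in_itv.
have sa : sin (acos x) = `|y|.
  rewrite sin_acos// -sqrtr_sqr; congr Num.sqrt; lra.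
have [y0|/ltW y0] := lerP 0 y.
  by exists (acos x); rewrite sa ger0_norm.
by exists (- acos x); rewrite cosN sinN sa ler0_norm// opprK.
Qed.

Lemma ex_polar_form (x y : R) : (x, y) != (0, 0) ->
  exists2 r : R, 0 < r & exists t, x = r * cos t /\ y = r * sin t.
Proof.
move=> xy0.
have h0 : 0 < x ^+ 2 + y ^+ 2.
  rewrite lt_neqAle addr_ge0 ?sqr_ge0// andbT eq_sym paddr_eq0 ?sqr_ge0//.
  by rewrite !sqrf_eq0; move: xy0; rewrite -pair_eqE.
set h := x ^+ 2 + y ^+ 2 in h0.
have r0 : 0 < Num.sqrt h by rewrite sqrtr_gt0.
exists (Num.sqrt h) => //.
have [|t [ct st]] := @ex_angle (x / Num.sqrt h) (y / Num.sqrt h).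
  rewrite !expr_div_n sqr_sqrtr ?(ltW h0)// -mulrDl divff//.
  by rewrite gt_eqF.
by exists t; rewrite ct st; split; field; rewrite gt_eqF.
Qed.

Lemma ex_polar q : disc q -> q != (0, 0) ->
  exists2 s, 0 <= s & exists t, q = polar s t.
Proof.
case: q => x y; rewrite /disc /= => xy1 xy0.
have [r r0 [t [xE yE]]] := ex_polar_form xy0.
have r1 : r <= 1.
  rewrite -(@ler_pXn2r _ 2) ?nnegrE// ?(ltW r0)// expr1n.
  apply: le_trans xy1; rewrite xE yE !exprMn -mulrDr cos2Dsin2 mulr1//.
exists (- ln r); first by rewrite oppr_ge0 ln_le0.
by exists (- t); rewrite /polar !opprK lnK ?posrE// xE yE.
Qed.

Lemma rot_polar t s t0 : rot t (polar s t0) = polar s (t0 - t).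
Proof.
rewrite /rot /polar /= opprB (_ : t - t0 = t + - t0)// cosD sinD.
by congr (_, _); ring.
Qed.

Lemma scale_polar r s t : scaleq (expR (- r)) (polar s t) = polar (r + s) t.
Proof. by rewrite /scaleq /polar opprD expRD !mulrA. Qed.

Lemma disc_scale k q : 0 <= k <= 1 -> disc q -> disc (scaleq k q).
Proof.
rewrite /disc /scaleq /= => /andP[k0 k1] q1; rewrite !exprMn -mulrDr.
rewrite mulr_ile1// ?addr_ge0 ?sqr_ge0//.
by rewrite expr2 mulr_ile1.
Qed.

Lemma disc0 : disc (0 : R, 0 : R).
Proof. by rewrite /disc /= expr0n /= addr0. Qed.

Lemma disc_le1 q : disc q -> `|q.1| <= 1 /\ `|q.2| <= 1.
Proof.
rewrite /disc /= => q1.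
split; rewrite -(@ler_pXn2r _ 2) ?nnegrE// real_normK ?num_real// expr1n.
  by have := sqr_ge0 q.2; lra.
by have := sqr_ge0 q.1; lra.
Qed.

Lemma disc_compact : compact (disc : set (R * R)).
Proof.
apply: (@subclosed_compact (R * R)%type disc (`[-1, 1]%classic `*` `[-1, 1]%classic)).
- rewrite (_ : disc = (fun q => q.1 ^+ 2 + q.2 ^+ 2) @^-1` [set x : R | x <= 1])//.
  apply: preimage_closed; last exact: closed_le.
  move=> q _.
  have c1 : {for q, continuous (fst : R * R -> R)} by exact: cvg_fst.
  have c2 : {for q, continuous (snd : R * R -> R)} by exact: cvg_snd.
  exact: continuousD (continuousM c1 c1) (continuousM c2 c2).
- by apply: compact_setX; exact: segment_compact.
- by move=> q /disc_le1[]; rewrite !ler_norml /= => h1 h2; split; rewrite /= in_itv.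
Qed.

End Polar.

(** * Symmetries of the gradient disc *)

Section GradientDisc.
Context {R : realType} {m : nat} {M : manifold R m}.
Variables (a g : R -> M -> M) (J : M -> 'M[R]_m).
Hypothesis a_act : smooth_Raction a.
Hypothesis J_inv : invariant_acs a J.
Hypothesis g_flow : is_flow g (fun x => generator a x *m J x).

(** The generator and J are invariant, so [a t] carries integral curves of J xi to integral curves;
    [flow_unique] identifies them. *)
Lemma flow_commute s t x : g s (a t x) = a t (g s x).
Proof.
have [ag gX] := g_flow.
have V r : velocity (a t \o g^~ x) r
    (generator a (a t (g r x)) *m J (a t (g r x))).
  have := velocity_map (act_velocity ag x r) (act_differentiable a_act t).
  rewrite gX -mulmxA [X in _ *m X]J_inv mulmxA.
  by rewrite (generator_invariant a_act).
by have /= -> := flow_unique g_flow V s; rewrite (ract0 ag).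
Qed.

Variables (p z : M) (u : R * R -> M).
Hypothesis u_disc : gradient_disc a g p z u.

Lemma gdisc_polar s t : 0 <= s -> u (polar s t) = g s (a t p).
Proof. by move=> s0; rewrite /polar (gdisc_eq u_disc). Qed.

(** The limit of a trajectory is a rest point: shifting time does not change the limit at infinity,
    and limits are unique in a Hausdorff space. *)
Lemma flow_fixed r : g r z = z.
Proof.
have [ag _] := g_flow.
have C1 : g r (g s p) @[s --> +oo] --> g r z.
  exact: (cvg_comp _ _ (gdisc_lim u_disc) (@act_continuous _ _ _ _ ag r z)).
have C2 : g (r + s) p @[s --> +oo] --> z.
  have A : (r + s : R) @[s --> +oo] --> +oo.
    apply/cvgryPge => B; near=> s.
    by rewrite -lerBlDl; near: s; apply: nbhs_pinfty_ge; exact: num_real.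
  exact: (cvg_comp _ _ A (gdisc_lim u_disc)).
apply: (cvg_unique (@mhausdorff _ _ M) C1).
rewrite (_ : (fun s => g r (g s p)) = (fun s => g (r + s) p))//.
by apply/funext => s; rewrite (ractD ag).
Unshelve. all: by end_near. Qed.

Lemma gdisc_rot t q : disc q -> u (rot (- t) q) = a t (u q).
Proof.
move=> qd; have [->|q0] := eqVneq q (0, 0).
  rewrite /rot /= !mulr0 subr0 addr0 (gdisc_center u_disc).
  by rewrite (gdisc_fixed u_disc).
have [s s0 [t0 ->]] := ex_polar qd q0.
by rewrite rot_polar opprK !gdisc_polar// -flow_commute -(ractD a_act) addrC.
Qed.

Lemma gdisc_scale r q : 0 <= r -> disc q -> u (scaleq (expR (- r)) q) = g r (u q).
Proof.
have [ag _] := g_flow.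
move=> r0 qd; have [->|q0] := eqVneq q (0, 0).
  by rewrite /scaleq /= !mulr0 (gdisc_center u_disc) flow_fixed.
have [s s0 [t0 ->]] := ex_polar qd q0.
by rewrite scale_polar !gdisc_polar// ?addr_ge0// (ractD ag).
Qed.

Lemma flow_disc_rot r t q : disc q ->
  g r (u (rot (- t) q)) = a t (g r (u q)).
Proof. by move=> qd; rewrite gdisc_rot// flow_commute. Qed.

Lemma gdisc_cvg q : disc q -> u q' @[q' --> within disc (nbhs q)] --> u q.
Proof.
by move: (gdisc_continuous u_disc) => /subspace_continuousP; apply.
Qed.

Lemma flow_disc_cvg r q : disc q ->
  g r (u q') @[q' --> within disc (nbhs q)] --> g r (u q).
Proof.
move=> qd; have [ag _] := g_flow.
exact: (cvg_comp _ _ (gdisc_cvg qd) (@act_continuous _ _ _ _ ag r (u q))).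
Qed.

(** Flowing for time -ln k rescales the disc by k, so continuity of [u] at the centre suffices. *)
Lemma gdisc_shrink (U : set M) : nbhs z U ->
  exists2 r, 0 <= r & forall q, disc q -> U (g r (u q)).
Proof.
move=> Uz.
have := gdisc_cvg disc0; rewrite (gdisc_center u_disc) => /(_ U Uz).
rewrite /= => /nbhs_ballP[e /= e0 eP].
(* The bound 1 makes the time -ln k nonnegative; the bound e / 2 puts the rescaled disc strictly
   inside the ball. *)
pose k := Num.min 1 (e / 2).
have k0 : 0 < k by rewrite lt_min ltr01 divr_gt0.
have k1 : k <= 1 by rewrite ge_min lexx.
have ke : k < e by rewrite gt_min; apply/orP; right; lra.
exists (- ln k); first by rewrite oppr_ge0 ln_le0.
move=> q qd; rewrite -gdisc_scale ?oppr_ge0 ?ln_le0// opprK lnK ?posrE//.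
apply: eP; last by apply: disc_scale => //; rewrite (ltW k0).
have [q1 q2] := disc_le1 qd.
by split; rewrite /ball/= sub0r normrN normrM (gtr0_norm k0)
  (le_lt_trans _ ke)// ler_piMr// ltW.
Qed.

End GradientDisc.

(** * Equivariant frames along the disc *)

Lemma unitmx_inj (F : fieldType) m (A : 'M[F]_m) :
  (forall v : 'rV_m, v *m A = 0 -> v = 0) -> A \in unitmx.
Proof. by move=> A0; rewrite -row_free_unit; exact: inj_row_free. Qed.

Lemma mulmx_tr_ge0 (R : realDomainType) m (v : 'rV[R]_m) : 0 <= (v *m v^T) 0 0.
Proof. by rewrite mxE sumr_ge0// => i _; rewrite !mxE -expr2 sqr_ge0. Qed.

Section Rot.
Context {R : realType} {n : nat}.
Variable c : 'I_n -> int.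

(** On row vectors this is multiplication by -i, the structure that the convention of a metric w(J
    v, v') pairs with [std_form]. *)
Definition std_acs : 'M[R]_(n + n) := block_mx 0 (- 1%:M) 1%:M 0.

Lemma std_formE : std_form = - std_acs.
Proof. by rewrite /std_acs /std_form opp_block_mx oppr0 opprK. Qed.

Lemma std_acs_sqr : std_acs *m std_acs = - 1%:M.
Proof.
rewrite /std_acs mulmx_block !mulmx0 !mul0mx mulNmx mulmxN !mulmx1.
by rewrite !addr0 !add0r [in RHS]scalar_mx_block opp_block_mx !oppr0.
Qed.

Lemma std_acs_form : std_acs *m std_form = 1%:M.
Proof. by rewrite std_formE mulmxN std_acs_sqr opprK. Qed.

Definition rotmx t : 'M[R]_(n + n) :=
  let C := diag_mx (\row_k cos (t *~ c k)) in
  let S := diag_mx (\row_k sin (t *~ c k)) in block_mx C S (- S) C.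

Lemma rotmx_acs t : rotmx t *m std_acs = std_acs *m rotmx t.
Proof.
rewrite /std_acs /rotmx !mulmx_block !mulmx0 !mul0mx !mulmxN !mulNmx !mulmx1 !mul1mx.
by rewrite !addr0 !add0r opprK.
Qed.

Lemma rotmxK t : rotmx (- t) *m rotmx t = 1%:M.
Proof.
rewrite /rotmx mulmx_block !mulmxN !mulNmx !mulmx_diag.
rewrite [RHS]scalar_mx_block.
by congr block_mx; apply/matrixP => i j; rewrite !mxE mulNrz cosN sinN;
  case: eqP => _; rewrite ?mulr1n ?mulr0n ?oppr0 ?addr0 //;
  have := cos2Dsin2 (t *~ c i); nra.
Qed.

End Rot.

Section Frames.
Context {R : realType} {n : nat} {M : manifold R (n + n)}.
Variables (w : M -> 'M[R]_(n + n)) (a : R -> M -> M) (J : M -> 'M[R]_(n + n)).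
Variable (c : 'I_n -> int).
Hypothesis a_act : smooth_Raction a.
Hypothesis J_compatible : compatible_acs w J.
Hypothesis J_inv : invariant_acs a J.
Notation J0 := (@std_acs R n).
Notation disc := (disc : set (R * R)).

Definition eframe (v : R * R -> M) (Y : R * R -> 'M[R]_(n + n)) : Prop :=
  (forall t q, disc q ->
    Y (rot (- t) q) = rotmx c (- t) *m Y q *m tangent_map (a t) (v q)) /\
  (forall q, disc q -> cvg_along (within disc (nbhs q)) v Y q).

Definition jframe (v : R * R -> M) (X : R * R -> 'M[R]_(n + n)) : Prop :=
  [/\ eframe v X, forall q, disc q -> X q *m J (v q) = J0 *m X q &
    forall q, disc q -> X q \in unitmx].

(** What the original disc and its images under the flow have in common; frames are built along all
    of them. *)
Definition equivariant_disc (v : R * R -> M) : Prop :=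
  (forall t q, disc q -> v (rot (- t) q) = a t (v q)) /\
  (forall q, disc q -> v q' @[q' --> within disc (nbhs q)] --> v q).

(* [Y - J0 Y J] is twice the complex linear part of [Y]. *)
Definition clin (v : R * R -> M) (Y : R * R -> 'M[R]_(n + n)) q :=
  Y q - J0 *m Y q *m J (v q).

(** [rotmx] commutes with [std_acs] and the differential of the action with J, so the projection
    inherits equivariance; only invertibility has to be supplied. *)
Lemma clin_frame v Y : equivariant_disc v -> eframe v Y ->
  (forall q, disc q -> clin v Y q \in unitmx) -> jframe v (clin v Y).
Proof.
move=> [ve vc] [Ye Yc] Yu; split=> //; first split.
- move=> t q qd; rewrite /clin ve// Ye// mulmxBr mulmxBl; congr (_ - _).
  rewrite !mulmxA -rotmx_acs -!mulmxA; do 3! congr (_ *m _).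
  by rewrite J_inv.
- move=> q qd; rewrite /clin.
  apply: cvg_alongD; first exact: Yc.
  have C1 := cvg_along_endo (vc q qd) (acs_smooth J_compatible) (Yc q qd) _.
  have C2 : cvg_along (within disc (nbhs q)) v
      (fun q' => (- J0) *m (Y q' *m J (v q'))) q.
    by apply: cvg_along_mulc; exact: C1.
  have -> : (fun r => - (J0 *m Y r *m J (v r))) =
      (fun q' => (- J0) *m (Y q' *m J (v q'))).
    by apply/funext => r; rewrite [RHS]mulNmx mulmxA.
  exact: C2.
- move=> q qd; rewrite /clin mulmxBl mulmxBr -!mulmxA (acs_sq J_compatible).
  by rewrite !mulmxN !mulmx1 opprK !mulmxA std_acs_sqr !mulNmx mul1mx opprK addrC.
Qed.

End Frames.

Lemma mulmx_rdiv (F : fieldType) m (A D E K : 'M[F]_m) :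
  A *m D = K -> D *m E = 1%:M -> A = K *m E.
Proof. by move=> <- DE; rewrite -mulmxA DE mulmx1. Qed.

Lemma unitmx_transfer (F : fieldType) m (A D K Q : 'M[F]_m) :
  A *m D = K *m Q -> K \in unitmx -> Q \in unitmx -> A \in unitmx.
Proof.
move=> E uK uQ; have : A *m D \in unitmx by rewrite E unitmx_mul uK.
by rewrite unitmx_mul => /andP[].
Qed.

Lemma clin_conj (F : fieldType) m (T J J' D D' Q A A' : 'M[F]_m) :
  T *m D' = D *m Q -> J *m D = D *m A -> J' *m D' = D' *m A' ->
  (T - J *m T *m J') *m D' = D *m (Q - A *m Q *m A').
Proof.
move=> TE JE JE'; rewrite mulmxBl mulmxBr TE; congr (_ - _).
by rewrite -[LHS]mulmxA JE' [LHS]mulmxA -(mulmxA J) TE !mulmxA JE.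
Qed.

Lemma mulmx_swap (F : fieldType) m (P X A T A' T' : 'M[F]_m) :
  A *m T' = T *m A' -> P *m X *m A *m T' = P *m (X *m T) *m A'.
Proof. by move=> E; rewrite -mulmxA E !mulmxA. Qed.

(** A complex linear [X] factors out of the projection. Whether a step preserves invertibility thus
    depends only on the differential [T], and not on the frame reached so far. *)
Lemma clin_factor (F : fieldType) m (I0 X J J' T : 'M[F]_m) :
  X *m J = I0 *m X ->
  X *m T - I0 *m (X *m T) *m J' = X *m (T - J *m T *m J').
Proof. by move=> E; rewrite mulmxBr !mulmxA E. Qed.

(** * Existence of an equivariant complex linear frame *)

Section FrameExistence.
Context {R : realType} {n : nat} {M : manifold R (n + n)}.
Variables (w : M -> 'M[R]_(n + n)) (a : R -> M -> M) (J : M -> 'M[R]_(n + n)).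
Variable (c : 'I_n -> int).
Hypothesis a_act : smooth_Raction a.
Hypothesis J_compatible : compatible_acs w J.
Hypothesis J_inv : invariant_acs a J.
Notation J0 := (@std_acs R n).
Notation disc := (disc : set (R * R)).

Section Darboux.
Variable f : chart R M (n + n).
Hypothesis f_smooth : smooth_chart f.
Hypothesis f_darboux : forall y, cim f y -> form_in f w y = std_form.
Hypothesis f_inv : forall t x, cdom f x -> cdom f (a t x).
Hypothesis f_rot : forall t x, cdom f x ->
  cmap f (a t x) = cmap f x *m rotmx c t.

Let B x := chart_inv_diff f (cmap f x).

Lemma darboux_frame_equivariant t x : cdom f x ->
  B (a t x) = rotmx c (- t) *m B x *m tangent_map (a t) x.
Proof.
move=> fx; have fax := f_inv t fx.
have [_ E] := tangent_map_jac (act_differentiable a_act t) f_smooth f_smooth fx fax.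
have jE : jac f f (a t) x = rotmx c t.
  rewrite jacE -[RHS](jacobian_mulmx _ (cmap f x)).2.
  apply: near_jacobian; last exact: (jacobian_mulmx _ _).1.
  apply: filterS (chart_near fx (near_cdom fx)) => y [fy _ fyE] /=.
  by rewrite (f_rot _ fy) fyE.
rewrite jE in E.
have {E}E : tangent_map (a t) x = chart_diff f x *m rotmx c t *m B (a t x).
  exact: mulmx_rdiv E (chart_diffK f_smooth fax).
have K := chart_inv_diffK f_smooth fx.
rewrite E; move: K (rotmxK c t); rewrite -/(B x).
move: (B x) (B (a t x)) (chart_diff f x) => B1 B2 D K1 K2.
by rewrite -!mulmxA (mulmxA B1) K1 mul1mx mulmxA K2 mul1mx.
Qed.

Lemma darboux_frame_form x : cdom f x -> B x *m w x *m (B x)^T = std_form.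
Proof.
move=> fx; rewrite -(f_darboux (y := cmap f x)); last by exists x.
by rewrite /form_in (cmapK fx).
Qed.

(** On a kernel vector [v] the frame is antilinear: J of [v *m B x] is minus the image of [v *m J0].
    Its pairing with [v *m B x] is positive by [acs_pos], yet equals minus the square norm of [v] by
    [std_acs_form]. *)
Lemma darboux_clin_unit x : cdom f x ->
  B x - J0 *m B x *m J x \in unitmx.
Proof.
move=> fx; apply: unitmx_inj => v; rewrite mulmxBr => /eqP.
rewrite subr_eq0 !mulmxA => /eqP vE.
apply/eqP/negPn/negP => v0.
have b0 : v *m B x != 0.
  apply: contra v0 => /eqP vB.
  rewrite -(mulmx1 v) -(mulmxV (chart_inv_diff_unit f_smooth fx)) mulmxA.
  by rewrite [v *m _]vB mul0mx.
have := acs_pos J_compatible x b0.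
have -> : v *m B x *m J x = - (v *m J0 *m B x).
  by rewrite vE -[LHS]mulmxA (acs_sq J_compatible) mulmxN mulmx1.
have -> : ev w x (- (v *m J0 *m B x)) (v *m B x) = - (v *m v^T) 0 0.
  rewrite /ev trmx_mul !mulNmx mxE; congr (- _).
  have -> : v *m J0 *m B x *m w x *m ((B x)^T *m v^T) =
    v *m J0 *m (B x *m w x *m (B x)^T) *m v^T by rewrite !mulmxA.
  by rewrite (darboux_frame_form fx) -(mulmxA v) std_acs_form mulmx1.
by rewrite oppr_gt0 ltNge mulmx_tr_ge0.
Qed.

End Darboux.

Variable g : R -> M -> M.
Hypothesis g_flow : is_flow g (fun x => generator a x *m J x).

(* At time 0 this is twice the identity. *)
Lemma flow_clin_near (x0 : M) : \forall x \near x0 & d \near (0 : R),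
  tangent_map (g (- d)) x - J x *m tangent_map (g (- d)) x *m J (g (- d) x)
    \in unitmx.
Proof.
have [ag _] := g_flow.
have cc := chart_at_dom x0; set k := chart_at x0 in cc.
pose Jk := endo_in k J.
(* The same expression in the fixed chart [k], where it is continuous in point and time; [clin_conj]
   transfers invertibility back at the end. *)
pose P (p : M * R) := jac k k (g (- p.2)) p.1 -
  Jk (cmap k p.1) *m jac k k (g (- p.2)) p.1 *m Jk (cmap k (g (- p.2) p.1)).
have g0 x : g (- 0) x = x by rewrite oppr0 (ract0 ag).
have kg : cdom k (g (- 0) x0) by rewrite g0.
have c1 : p.1 @[p --> (x0, 0 : R)] --> x0 by exact: cvg_fst.
have c2 : - p.2 @[p --> (x0, 0 : R)] --> - (0 : R).
  by apply: cvgN; exact: cvg_snd.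
have c3 : g (- p.2) p.1 @[p --> (x0, 0 : R)] --> g (- 0) x0.
  exact: (act_cvg ag _ c2 c1).
have c4 : jac k k (g (- p.2)) p.1 @[p --> (x0, 0 : R)] --> jac k k (g (- 0)) x0.
  exact: (cvg_comp _ _ (cvg_pair c2 c1) (jac_act_cvg ag cc kg)).
have cJ x : cdom k x -> {for cmap k x, continuous Jk}.
  by move=> kx; apply: (smooth_on_continuous (acs_smooth J_compatible x0)); exists x.
have c5 : Jk (cmap k p.1) @[p --> (x0, 0 : R)] --> Jk (cmap k x0).
  exact: (cvg_comp _ _ (cvg_comp _ _ c1 (cmap_continuous cc)) (cJ _ cc)).
have c6 : Jk (cmap k (g (- p.2) p.1)) @[p --> (x0, 0 : R)] -->
    Jk (cmap k (g (- 0) x0)).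
  exact: (cvg_comp _ _ (cvg_comp _ _ c3 (cmap_continuous kg)) (cJ _ kg)).
have cP : P p @[p --> (x0, 0 : R)] --> P (x0, 0).
  exact: (cvgB c4 (cvg_mulmx _ (cvg_mulmx _ c5 c4) c6)).
have JJ : Jk (cmap k x0) *m Jk (cmap k x0) = - 1%:M.
  have E := endo_inE J (chart_at_smooth_chart x0) cc.
  have U := chart_diff_unit (chart_at_smooth_chart x0) cc.
  apply: (can_inj (mulKmx U)).
  rewrite mulmxA -E -mulmxA -E mulmxA (acs_sq J_compatible).
  by rewrite mulNmx mul1mx mulmxN mulmx1.
have P0 : \det (P (x0, 0)) != 0.
  rewrite /P /= g0.
  have -> : g (- 0) = id by apply/funext => x; rewrite g0.
  rewrite (jac_id_refl cc) mulmx1 JJ opprK -mulr2n -scaler_nat.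
  by rewrite detZ det1 mulr1 expf_neq0// pnatr_eq0.
have near1 : \forall p \near (x0, 0 : R), \det (P p) != 0.
  have cd : \det (P p) @[p --> (x0, 0 : R)] --> \det (P (x0, 0)).
    exact: cvg_det cP.
  by apply: cvgr_neq0 cd P0.
have near2 : \forall p \near (x0, 0 : R), cdom k p.1 by exact: c1 _ (near_cdom cc).
have near3 : \forall p \near (x0, 0 : R), cdom k (g (- p.2) p.1).
  exact: c3 _ (near_cdom kg).
apply: filterS3 near1 near2 near3 => -[x d] /= Pu kx kgx.
have sk := chart_at_smooth_chart x0.
have [_ TE] := tangent_map_jac (act_differentiable ag (- d)) sk sk kx kgx.
have U1 := chart_diff_unit sk kx.
have Pd : P (x, d) \in unitmx by rewrite unitmxE unitfE.
have E := clin_conj TE (endo_inE J sk kx) (endo_inE J sk kgx).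
exact: unitmx_transfer E U1 Pd.
Qed.

Variables (p z : M) (u : R * R -> M).
Hypothesis u_disc : gradient_disc a g p z u.

(** Compactness of the image of the disc makes the local bounds uniform. As the flow maps this image
    into itself in positive time, one step size works throughout. *)
Lemma flow_clin_unit : exists2 d0 : R, 0 < d0 & forall d, 0 <= d < d0 ->
  forall x, (u @` disc) x ->
  tangent_map (g (- d)) x - J x *m tangent_map (g (- d)) x *m J (g (- d) x)
    \in unitmx.
Proof.
have K : compact (u @` disc).
  by apply: continuous_compact; [exact: gdisc_continuous u_disc|exact: disc_compact].
have /compact_near_coveringP/(_ R (nbhs (0 : R)) (fun d x =>
  tangent_map (g (- d)) x - J x *m tangent_map (g (- d)) x *m J (g (- d) x)
    \in unitmx) _) := K.
move=> /(_ (fun x _ => flow_clin_near x)) /nbhs_ballP[d0 /= d00 H].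
exists d0 => // d /andP[d1 d2] x Kx; apply: H => //.
by rewrite /ball/= sub0r normrN ger0_norm.
Qed.

Lemma flow_disc_equivariant r : equivariant_disc a (fun q => g r (u q)).
Proof.
split=> [t q qd|q qd]; first exact: (flow_disc_rot a_act J_inv g_flow u_disc).
exact: (flow_disc_cvg g_flow u_disc).
Qed.

Lemma tangent_flow_act s t x :
  tangent_map (a t) x *m tangent_map (g s) (a t x) =
  tangent_map (g s) x *m tangent_map (a t) (g s x).
Proof.
have [ag _] := g_flow.
have D1 := act_differentiable a_act t; have D2 := act_differentiable ag s.
have E : g s \o a t = a t \o g s.
  by apply/funext => y; exact: (flow_commute a_act J_inv g_flow).
apply: etrans (esym (@tangent_map_comp _ _ _ (a t) (g s) x D1 D2)) _.
by rewrite E; exact: tangent_map_comp.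
Qed.

Lemma jframe_step r d X : 0 <= r + d ->
  (forall x, (u @` disc) x ->
    tangent_map (g (- d)) x - J x *m tangent_map (g (- d)) x *m J (g (- d) x)
    \in unitmx) ->
  jframe a J c (fun q => g (r + d) (u q)) X ->
  exists X', jframe a J c (fun q => g r (u q)) X'.
Proof.
have [ag _] := g_flow.
move=> rd0 U [[Xe Xc] XJ Xu].
have vE q : g (- d) (g (r + d) (u q)) = g r (u q).
  by rewrite -(ractD ag) addrC addrK.
pose Y q := X q *m tangent_map (g (- d)) (g (r + d) (u q)).
exists (clin J (fun q => g r (u q)) Y).
apply: (clin_frame J_compatible J_inv (flow_disc_equivariant r)).
- split=> [t q qd|q qd].
    rewrite /Y (Xe _ _ qd).
    have -> := flow_disc_rot a_act J_inv g_flow u_disc (r + d) t qd.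
    apply: mulmx_swap; have := tangent_flow_act (- d) t (g (r + d) (u q)).
    by rewrite vE.
  have : cvg_along (within disc (nbhs q)) (g (- d) \o (fun q => g (r + d) (u q))) Y q.
    exact: (cvg_along_act ((flow_disc_equivariant (r + d)).2 q qd) ag (Xc q qd)).
  suff -> : g (- d) \o (fun q => g (r + d) (u q)) = (fun q => g r (u q)) by apply.
  by apply/funext => q'; exact: vE.
- move=> q qd; rewrite /clin /Y.
  rewrite (clin_factor _ _ (XJ q qd)) unitmx_mul Xu//= -vE; apply: U.
  (* The nonnegative time [r + d] keeps the point in the image of the disc, where the step is
     admissible. *)
  by exists (scaleq (expR (- (r + d))) q);
    [apply: disc_scale => //; rewrite expR_ge0 expR_le1 oppr_le0|
     rewrite (gdisc_scale g_flow u_disc)].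
Qed.

Variable f : chart R M (n + n).
Hypothesis f_smooth : smooth_chart f.
Hypothesis f_z : cdom f z.
Hypothesis f_darboux : forall y, cim f y -> form_in f w y = std_form.
Hypothesis f_inv : forall t x, cdom f x -> cdom f (a t x).
Hypothesis f_rot : forall t x, cdom f x ->
  cmap f (a t x) = cmap f x *m rotmx c t.

Lemma ex_jframe : exists X, jframe a J c u X.
Proof.
have [ag _] := g_flow.
have [S S0 fS] := gdisc_shrink g_flow u_disc (near_cdom f_z).
have [d0 d00 Hd] := flow_clin_unit.
(* The total time [S] is cut into [N.+1] equal steps, each shorter than the uniform bound [d0]. *)
have [N SN] : exists N : nat, S / N.+1%:R < d0.
  exists (Num.truncn (S / d0)).
  rewrite ltr_pdivrMr// mulrC -ltr_pdivrMr//.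
  exact: truncnS_gt.
set d := S / N.+1%:R in SN.
have dd : 0 <= d < d0 by rewrite SN divr_ge0.
(* After [k] steps the remaining flow time is (N + 1 - k) d: it starts at [S], with the whole disc
   in the Darboux chart, and ends at 0. *)
have H k : (k <= N.+1)%N ->
    exists X, jframe a J c (fun q => g ((N.+1 - k)%N%:R * d) (u q)) X.
  elim: k => [_|k IH kN].
    exists (clin J (fun q => g S (u q))
      (fun q => chart_inv_diff f (cmap f (g S (u q))))).
    rewrite subn0 mulrC divfK ?pnatr_eq0//.
    apply: (clin_frame J_compatible J_inv (flow_disc_equivariant S)).
    - split=> [t q qd|q qd].
        have -> := flow_disc_rot a_act J_inv g_flow u_disc S t qd.
        exact: darboux_frame_equivariant (fS q qd).
      exact: (cvg_along_chart ((flow_disc_equivariant S).2 q qd) f_smooth (fS q qd)).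
    - move=> q qd; exact: darboux_clin_unit (fS q qd).
  have [X XH] := IH (ltnW kN).
  apply: (@jframe_step _ d X).
  - by rewrite addr_ge0 ?mulr_ge0//; case/andP: dd.
  - by move=> x Kx; apply: Hd.
  have -> : (N.+1 - k.+1)%:R * d + d = (N.+1 - k)%:R * d.
    by rewrite -{2}(mul1r d) -mulrDl natr1 subnSK.
  exact: XH.
have [X XH] := H N.+1 (leqnn _); exists X.
move: XH; rewrite subnn mul0r.
suff -> : (fun q => g 0 (u q)) = u by [].
by apply/funext => q; rewrite (ract0 ag).
Qed.

End FrameExistence.

Lemma gs_step_map (R : realType) (m m' n : nat) (j : 'rV[R]_m -> 'rV[R]_m)
    (g : 'rV[R]_m -> 'rV[R]_m -> R) (j' : 'rV[R]_m' -> 'rV[R]_m')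
    (g' : 'rV[R]_m' -> 'rV[R]_m' -> R) (T : 'M[R]_(m, m'))
    (k : 'I_n) (e : 'I_n -> 'rV[R]_m) :
  (forall u v, g' (u *m T) (v *m T) = g u v) ->
  (forall u, j' (u *m T) = j u *m T) ->
  gs_step j' g' k (fun l => e l *m T) = (fun l => gs_step j g k e l *m T).
Proof.
move=> gT jT; apply/funext => l; rewrite /gs_step gT; case: eqP => _.
  by rewrite scalemxAl.
by rewrite /hproj jT !gT mulmxBl -!scalemxAl mulmxDl -!scalemxAl.
Qed.

Lemma row_diag_mul (F : pzRingType) m k (d : 'rV[F]_m) (A : 'M[F]_(m, k)) i :
  row i (diag_mx d *m A) = d 0 i *: row i A.
Proof. by rewrite row_mul row_diag_mx -scalemxAl -rowE. Qed.

(** * From complex linear to unitary frames *)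

Section Unitary.
Context {R : realType} {n : nat} {M : manifold R (n + n)}.
Variables (w : M -> 'M[R]_(n + n)) (a : R -> M -> M) (J : M -> 'M[R]_(n + n)).
Variable (c : 'I_n -> int).
Hypothesis w_sympl : symplectic_form w.
Hypothesis J_compatible : compatible_acs w J.
Hypothesis J_inv : invariant_acs a J.
Hypothesis w_inv : forall t x, tangent_map (a t) x *m w (a t x) *m
  (tangent_map (a t) x)^T = w x.
Notation J0 := (@std_acs R n).
Notation disc := (disc : set (R * R)).

Definition jx (x : M) (v : 'rV[R]_(n + n)) := v *m J x.
Definition gx (x : M) (v v' : 'rV[R]_(n + n)) := ev w x (v *m J x) v'.

Lemma evD x b v v' v'' : ev w x (b *: v + v') v'' = b * ev w x v v'' + ev w x v' v''.
Proof. by rewrite /ev !mulmxDl -!scalemxAl !mxE. Qed.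

Lemma evDr x v v' v'' : ev w x v'' (v + v') = ev w x v'' v + ev w x v'' v'.
Proof. by rewrite /ev linearD /= mulmxDr mxE. Qed.

Lemma evNl x v v' : ev w x (- v) v' = - ev w x v v'.
Proof. by rewrite /ev !mulNmx mxE. Qed.

Lemma evNr x v v' : ev w x v (- v') = - ev w x v v'.
Proof. by rewrite /ev linearN /= mulmxN mxE. Qed.

Lemma evC x v v' : ev w x v v' = - ev w x v' v.
Proof.
have Dl u u' u'' : ev w x (u + u') u'' = ev w x u u'' + ev w x u' u''.
  by rewrite -[u]scale1r evD mul1r scale1r.
have := sympl_alt w_sympl x (v + v').
by rewrite evDr !Dl !(sympl_alt w_sympl); lra.
Qed.

Lemma jx_lin x : linear (jx x).
Proof. by move=> b v v'; rewrite /jx mulmxDl -scalemxAl. Qed.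

Lemma jxjx x v : jx x (jx x v) = - v.
Proof. by rewrite /jx -mulmxA (acs_sq J_compatible) mulmxN mulmx1. Qed.

Lemma gx_lin x b v v' v'' : gx x (b *: v + v') v'' = b * gx x v v'' + gx x v' v''.
Proof. by rewrite /gx mulmxDl -scalemxAl evD. Qed.

Lemma gxC x v v' : gx x v v' = gx x v' v.
Proof.
rewrite /gx -(acs_inv J_compatible) -[v *m J x *m J x]/(jx x (jx x v)) jxjx.
by rewrite evNl [RHS]evC.
Qed.

Lemma gxj x v v' : gx x (jx x v) (jx x v') = gx x v v'.
Proof. by rewrite /gx (acs_inv J_compatible). Qed.

Lemma gx_pos x v : v != 0 -> 0 < gx x v v.
Proof. by move=> v0; exact: (acs_pos J_compatible). Qed.

Definition gsx x := @gs_step R (n + n) n (jx x) (gx x).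

(** A complex linear frame is determined by its first n rows. Because [std_acs] is multiplication by
    -i, the row for y_k is minus J of the row for x_k. *)
Definition mkframe (x : M) (e : 'I_n -> 'rV[R]_(n + n)) : 'M[R]_(n + n) :=
  col_mx (\matrix_l e l) (- ((\matrix_l e l) *m J x)).

Lemma row_mkframe_l x e l : row (lshift n l) (mkframe x e) = e l.
Proof. by rewrite /mkframe rowKu rowK. Qed.

Lemma row_mkframe_r x e l : row (rshift n l) (mkframe x e) = - jx x (e l).
Proof. by rewrite /mkframe rowKd linearN /= row_mul rowK. Qed.

Lemma mkframeE x X : X *m J x = J0 *m X ->
  mkframe x (fun l => row (lshift n l) X) = X.
Proof.
move=> XJ; apply/row_matrixP => i; rewrite -(@fintype.splitK n n i).
case: (fintype.split i) => l /=; first by rewrite row_mkframe_l.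
rewrite row_mkframe_r /jx -row_mul XJ -[X in J0 *m X]vsubmxK /std_acs.
rewrite mul_block_col !mul0mx !mulNmx !mul1mx add0r rowKu linearN opprK.
by rewrite -[in RHS](vsubmxK X) rowKd.
Qed.

Lemma mkframe_unit_step x (k : 'I_n) e : mkframe x e \in unitmx ->
  e k != 0 /\ mkframe x (gsx x k e) \in unitmx.
Proof.
move=> U.
have ek0 : e k != 0.
  apply/eqP => ek.
  have := row_mkframe_l x e k; rewrite ek rowE.
  move=> /(congr1 (mulmx^~ (invmx (mkframe x e)))).
  rewrite /= (mulmxK U) mul0mx => /matrixP/(_ 0 (lshift n k)).
  by rewrite !mxE !eqxx => /eqP; rewrite oner_eq0.
split=> //; rewrite -row_full_unit -sub1mx.
rewrite -row_full_unit -sub1mx in U; apply: submx_trans U _.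
pose e' := gsx x k e; rewrite -/e'.
have s1 l : (e' l <= mkframe x e')%MS.
  by rewrite -(row_mkframe_l x e' l); exact: row_sub.
have s2 l : (jx x (e' l) <= mkframe x e')%MS.
  rewrite -[jx x _]opprK -(row_mkframe_r x e' l) eqmx_opp; exact: row_sub.
have sp l := @gs_step_span R (n + n) n (jx x) (gx x) (jx_lin x) (gx_pos x) k e l ek0.
apply/row_subP => i; rewrite -(@fintype.splitK n n i); case: (fintype.split i) => l /=.
  rewrite row_mkframe_l; have [b [d [b' _ ->]]] := sp l.
  apply: addmx_sub; first by apply: scalemx_sub; exact: s1.
  case: eqP => _; first exact: sub0mx.
  by apply: addmx_sub; apply: scalemx_sub; [exact: s1|exact: s2].
rewrite row_mkframe_r eqmx_opp.
have [b [d [b' _ ->]]] := sp l.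
rewrite (jD (jx_lin x)) (jZ (jx_lin x)).
apply: addmx_sub; first by apply: scalemx_sub; exact: s2.
case: eqP => _; first by rewrite (j0 (jx_lin x)) sub0mx.
rewrite (jD (jx_lin x)) !(jZ (jx_lin x)) jxjx.
apply: addmx_sub; apply: scalemx_sub; first exact: s2.
by rewrite eqmx_opp; exact: s1.
Qed.

(** By J-invariance w(v, v') = g(v, J v'), so the two families of relations in [orthonormal_upto]
    are exactly the entries of [std_form]. *)
Lemma mkframe_sympl x e : orthonormal_upto (jx x) (gx x) n e ->
  mkframe x e *m w x *m (mkframe x e)^T = std_form.
Proof.
move=> oe; have {}oe i l := oe i l (ltn_ord i).
have E i l : (mkframe x e *m w x *m (mkframe x e)^T) i l =
    ev w x (row i (mkframe x e)) (row l (mkframe x e)).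
  rewrite /ev -row_mul [LHS]mxE [RHS]mxE; apply: eq_bigr => k _.
  by congr (_ * _); rewrite !mxE.
have eg v v' : ev w x v v' = gx x v (jx x v').
  by rewrite /gx /jx (acs_inv J_compatible).
have ge v v' : ev w x (jx x v) v' = gx x v v' by [].
apply/matrixP => i l; rewrite E -(@fintype.splitK n n i) -(@fintype.splitK n n l).
case: (fintype.split i) => {}i; case: (fintype.split l) => {}l /=;
  rewrite ?row_mkframe_l ?row_mkframe_r /std_form
  ?block_mxEul ?block_mxEur ?block_mxEdl ?block_mxEdr.
- by rewrite eg (oe i l).2 mxE.
- by rewrite evNr evC opprK ge (oe l i).1 mxE eq_sym.
- by rewrite evNl ge (oe i l).1 !mxE.
- by rewrite evNl evNr opprK ge (oe i l).2 mxE.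
Qed.

Variable u : R * R -> M.
Hypothesis u_equi : equivariant_disc a u.

Lemma gx_tangent t x v v' :
  gx (a t x) (v *m tangent_map (a t) x) (v' *m tangent_map (a t) x) = gx x v v'.
Proof.
rewrite /gx -mulmxA -J_inv /ev trmx_mul -[in RHS](w_inv t x).
by rewrite !mulmxA.
Qed.

Lemma jx_tangent t x v :
  jx (a t x) (v *m tangent_map (a t) x) = jx x v *m tangent_map (a t) x.
Proof. by rewrite /jx -mulmxA -J_inv mulmxA. Qed.

(** The equivariance of [eframe] on the first n rows. Since J corresponds to -i, the phase e^(-i c_l
    t) of [rotmx c (- t)] is [cscale] with the positive angle. *)
Definition row_equivariant (e : R * R -> 'I_n -> 'rV[R]_(n + n)) :=
  forall t q, disc q -> e (rot (- t) q) = (fun l =>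
    cscale (jx (u q)) (cos (t *~ c l)) (sin (t *~ c l)) (e q l)
    *m tangent_map (a t) (u q)).

Lemma rotmx_top t (X : 'M[R]_(n + n)) l :
  row (lshift n l) (rotmx c t *m X) =
  cos (t *~ c l) *: row (lshift n l) X + sin (t *~ c l) *: row (rshift n l) X.
Proof.
rewrite -{1}(vsubmxK X) /rotmx mul_block_col rowKu linearD /=.
by rewrite !row_diag_mul !mxE row_usubmx row_dsubmx.
Qed.

Lemma rotmx_bot t (X : 'M[R]_(n + n)) l :
  row (rshift n l) (rotmx c t *m X) =
  - sin (t *~ c l) *: row (lshift n l) X + cos (t *~ c l) *: row (rshift n l) X.
Proof.
rewrite -{1}(vsubmxK X) /rotmx mul_block_col rowKd linearD /= mulNmx linearN /=.
by rewrite !row_diag_mul !mxE row_usubmx row_dsubmx scaleNr.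
Qed.

(** The differential of the action is unitary and passes through the step by naturality,
    [gs_step_map]; the remaining phases pass by [gs_step_cscale]. *)
Lemma gs_step_equivariant k e : row_equivariant e ->
  row_equivariant (fun q => gsx (u q) k (e q)).
Proof.
move=> ee t q qd; rewrite ee// u_equi.1//.
rewrite /gsx (gs_step_map k _ (gx_tangent t (u q)) (jx_tangent t (u q))).
rewrite gs_step_cscale//.
- exact: jx_lin.
- exact: jxjx.
- exact: gx_lin.
- exact: gxC.
- exact: gxj.
- by move=> l; exact: cos2Dsin2.
Qed.

Lemma mkframe_equivariant e t q : row_equivariant e -> disc q ->
  mkframe (u (rot (- t) q)) (e (rot (- t) q)) =
  rotmx c (- t) *m mkframe (u q) (e q) *m tangent_map (a t) (u q).
Proof.
move=> ee qd; apply/row_matrixP => i.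
rewrite -(@fintype.splitK n n i); case: (fintype.split i) => {}i /=.
  rewrite row_mul rotmx_top row_mkframe_l row_mkframe_l row_mkframe_r.
  rewrite ee// /cscale mulNrz cosN sinN scalerN scaleNr opprK.
  by [].
rewrite row_mul rotmx_bot !row_mkframe_r row_mkframe_l.
rewrite ee// u_equi.1// jx_tangent -mulNmx; congr (_ *m _).
rewrite /cscale (jD (jx_lin _)) !(jZ (jx_lin _)) jxjx mulNrz cosN sinN.
by rewrite opprK scalerN opprD opprK scalerN addrC.
Qed.

Lemma cvg_gs_step e k q : disc q -> e q k != 0 ->
  (forall l, cvg_along (within disc (nbhs q)) u (e^~ l) q) ->
  forall l, cvg_along (within disc (nbhs q)) u (fun q => gsx (u q) k (e q) l) q.
Proof.
move=> qd ek0 ec l.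
have uc := u_equi.2 q qd.
have cJ l' : cvg_along (within disc (nbhs q)) u (fun q => jx (u q) (e q l')) q.
  exact: (cvg_along_endo uc (acs_smooth J_compatible) (ec l')).
have cg l1 l2 : gx (u q') (e q' l1) (e q' l2) @[q' --> within disc (nbhs q)] -->
    gx (u q) (e q l1) (e q l2).
  exact: (cvg_ev uc (sympl_smooth w_sympl) (cJ l1) (ec l2)).
have cgj l1 l2 : gx (u q') (e q' l1) (jx (u q') (e q' l2))
     @[q' --> within disc (nbhs q)] --> gx (u q) (e q l1) (jx (u q) (e q l2)).
  exact: (cvg_ev uc (sympl_smooth w_sympl) (cJ l1) (cJ l2)).
have gk := gx_pos (u q) ek0.
have gk0 : gx (u q) (e q k) (e q k) != 0 by rewrite gt_eqF.
rewrite /gsx /gs_step; case: eqP => _.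
  apply: cvg_alongZ; last exact: ec.
  apply: cvgV; first by rewrite gt_eqF// sqrtr_gt0.
  exact: (cvg_comp _ _ (cg k k) (@sqrt_continuous R _)).
rewrite /hproj.
apply: cvg_alongD; first exact: ec.
have -> : (fun r => - ((gx (u r) (e r k) (e r k))^-1 *:
    (gx (u r) (e r l) (e r k) *: e r k +
     gx (u r) (e r l) (jx (u r) (e r k)) *: jx (u r) (e r k)))) =
  (fun r => - (gx (u r) (e r k) (e r k))^-1 *:
    (gx (u r) (e r l) (e r k) *: e r k +
     gx (u r) (e r l) (jx (u r) (e r k)) *: jx (u r) (e r k))).
  by apply/funext => r; rewrite scaleNr.
apply: cvg_alongZ; first by apply: cvgN; apply: cvgV.
apply: cvg_alongD; apply: cvg_alongZ.
- exact: cg.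
- exact: ec.
- exact: cgj.
- exact: cJ.
Qed.

Lemma cvg_mkframe e q : disc q ->
  (forall l, cvg_along (within disc (nbhs q)) u (e^~ l) q) ->
  cvg_along (within disc (nbhs q)) u (fun q => mkframe (u q) (e q)) q.
Proof.
move=> qd ec; have uc := u_equi.2 q qd; apply: cvg_along_rows => i.
rewrite -(@fintype.splitK n n i); case: (fintype.split i) => {}i /=.
  have -> : (fun r => row (lshift n i) (mkframe (u r) (e r))) = e^~ i.
    by apply/funext => r; rewrite row_mkframe_l.
  exact: ec.
have -> : (fun r => row (rshift n i) (mkframe (u r) (e r))) =
    (fun r => (-1) *: jx (u r) (e r i)).
  by apply/funext => r; rewrite row_mkframe_r scaleN1r.
apply: cvg_alongZ; first exact: cvg_cst.
exact: (cvg_along_endo uc (acs_smooth J_compatible) (ec i)).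
Qed.

Lemma ex_unitary_frame X : jframe a J c u X ->
  exists Phi : R * R -> 'M[R]_(n + n), eframe a c u Phi /\
    forall q, disc q -> Phi q *m w (u q) *m (Phi q)^T = std_form.
Proof.
move=> [[Xe Xc] XJ Xu].
have H K : (K <= n)%N -> exists e, [/\ row_equivariant e,
    forall q, disc q -> forall l, cvg_along (within disc (nbhs q)) u (e^~ l) q,
    forall q, disc q -> mkframe (u q) (e q) \in unitmx &
    forall q, disc q -> orthonormal_upto (jx (u q)) (gx (u q)) K (e q)].
  elim: K => [_|K IH Kn].
    exists (fun q l => row (lshift n l) (X q)); split.
    - move=> t q qd; apply/funext => l.
      rewrite Xe// row_mul rotmx_top /cscale; congr (_ *m _).
      rewrite mulNrz cosN sinN; congr (_ + _).
      rewrite scaleNr -scalerN; congr (_ *: _).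
      rewrite -{1}(mkframeE (XJ q qd)) row_mkframe_r opprK.
      by [].
    - by move=> q qd l; apply: cvg_along_row; exact: Xc.
    - by move=> q qd; rewrite (mkframeE (XJ q qd)) Xu.
    - by move=> q qd i l.
  have [e [e1 e2 e3 e4]] := IH (ltnW Kn).
  pose k := Ordinal Kn.
  exists (fun q => gsx (u q) k (e q)).
  have ek q : disc q -> e q k != 0 by move=> qd; exact: (mkframe_unit_step k (e3 q qd)).1.
  split.
  - exact: gs_step_equivariant.
  - move=> q qd; apply: cvg_gs_step => //; [exact: ek|exact: e2].
  - by move=> q qd; exact: (mkframe_unit_step k (e3 q qd)).2.
  - move=> q qd.
    exact: (gs_step_orthonormal (jx_lin (u q)) (jxjx (u q)) (gx_lin (u q))
      (gxC (u q)) (gxj (u q)) (gx_pos (u q)) (ek q qd) (e4 q qd : orthonormal_upto _ _ k _)).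
have [e [e1 e2 e3 e4]] := H n (leqnn _).
exists (fun q => mkframe (u q) (e q)); split; first split.
- by move=> t q qd; exact: mkframe_equivariant.
- by move=> q qd; apply: cvg_mkframe => //; exact: e2.
- by move=> q qd; apply: mkframe_sympl; exact: e4.
Qed.

End Unitary.

(** * Lagrangian subspaces and the Maslov index *)

Lemma is_derive1_line (R : realType) (V : normedModType R) (x y : V) (t : R) :
  is_derive t (1 : R) (fun r : R => x + r *: y) y.
Proof.
have d2 : differentiable (fun r : R => r *: y) t by exact: differentiableZl.
have d1 : differentiable (cst x : R -> V) t by [].
have d := differentiableD d1 d2.
split; first by apply: diff_derivable; exact: d.
rewrite (deriveE _ d) (diffD d1 d2) diff_cst diffZl//.
have /= -> : 'd (id : R -> R) t = id :> (R -> R) by exact: diff_val.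
by rewrite /= add0r scale1r.
Qed.

(** * Tangent spaces of submanifolds *)

Section TangentSpace.
Context {R : realType} {m : nat} {M : manifold R m}.

Lemma tangent_to_act (a : R -> M -> M) (L : set M) t x v :
  smooth_Raction a -> (forall t x, L x -> L (a t x)) ->
  tangent_to L x v -> tangent_to L (a t x) (v *m tangent_map (a t) x).
Proof.
move=> sa La [s [s0 cs sL ds]].
have V : velocity s 0 v by split => //; rewrite s0.
have [c1 c2] := velocity_map V (act_differentiable sa t).
exists (a t \o s); split.
- by rewrite /= s0.
- exact: c1.
- by apply: filterS sL => r /La; apply.
- by move: c2; rewrite /= s0.
Qed.

Lemma tangent_to_act_iff (a : R -> M -> M) (L : set M) k (F : 'M[R]_(k, m)) t x :
  smooth_Raction a -> (forall t x, L x -> L (a t x)) ->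
  (forall v, tangent_to L x v <-> (v <= F)%MS) ->
  forall v, tangent_to L (a t x) v <-> (v <= F *m tangent_map (a t) x)%MS.
Proof.
move=> sa La LF v; split.
  move=> /(tangent_to_act (- t) sa La).
  rewrite -(ractD sa) addNr (ract0 sa) => /LF.
  move=> /(submxMr (tangent_map (a t) x)).
  suff -> : v *m tangent_map (a (- t)) (a t x) *m tangent_map (a t) x = v by [].
  have := tangent_actK sa (- t) (a t x).
  rewrite -(ractD sa) addNr (ract0 sa) opprK => E.
  by rewrite -mulmxA E mulmx1.
move=> /submxP[D ->]; rewrite mulmxA.
by apply: tangent_to_act => //; apply/LF; exact: submxMl.
Qed.

(** [tangent_to] is defined by curves, so its linearity needs proof: in an adapted chart the tangent
    vectors are those whose coordinates from [d] on vanish. *)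
Lemma tangent_toP (L : set M) d x : L x -> submanifold_at L d x ->
  exists F : 'M[R]_(d, m), row_free F /\
    forall v, tangent_to L x v <-> (v <= F)%MS.
Proof.
move=> Lx [dm [k [sk kx kL]]].
have k0 (j : 'I_m) : (d <= j)%N -> cmap k x 0 j = 0 by exact: (kL x kx).1.
pose D := chart_diff k x; pose E := chart_inv_diff k (cmap k x).
have DE : D *m E = 1%:M by exact: chart_diffK.
have ED : E *m D = 1%:M by exact: chart_inv_diffK.
have uE : row_free E.
  by rewrite row_free_unit; exact: (mulmx1_unit DE).2.
(* The first [d] coordinate vectors of the adapted chart, carried to the tangent space at [x]. *)
exists ((pid_mx d : 'M[R]_(d, m)) *m E); split.
  by rewrite /row_free mxrankMfree// rank_pid_mx.
have tP v : tangent_to L x v <-> forall j : 'I_m, (d <= j)%N -> (v *m D) 0 j = 0.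
  split.
    move=> [s [s0 cs sL ds]] j dj.
    have V : velocity s 0 v by split => //; rewrite s0.
    have ks : cdom k (s 0) by rewrite s0.
    have := is_derive1_coord j (velocity_chart V sk ks).
    rewrite s0 => -[_ <-].
    rewrite (near_eq_derive (g := cst 0)); first by rewrite derive_cst.
    have kn : \forall r \near (0 : R), cdom k (s r) by exact: cs _ (near_cdom ks).
    apply: filterS2 sL kn => r Lr kr.
    by have /(_ j dj) := (kL _ kr).1 Lr.
  move=> vD.
  (* The submanifold is a coordinate subspace in this chart, so a straight line with such a
     direction stays in it. *)
  pose l (r : R) := cmap k x + r *: (v *m D).
  have l0 : l 0 = cmap k x by rewrite /l scale0r addr0.
  have dl : is_derive (0 : R) (1 : R) l (v *m D).
    exact: is_derive1_line.
  have cl : {for (0 : R), continuous l}.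
    by case: dl => /derivable1_diffP/differentiable_continuous.
  exists (cinv k \o l); split.
  - by rewrite /= l0 (cmapK kx).
  - apply: continuous_comp => //; rewrite l0; exact: cinv_continuous.
  - have H : \forall r \near (0 : R), [/\ cdom k (cinv k (l r)),
        cdom k (cinv k (l r)) & cmap k (cinv k (l r)) = l r].
      have H0 := chart_near kx (near_cdom kx); rewrite -l0 in H0.
      exact: (cl _ H0).
    apply: filterS H => r [kr _ krE].
    apply/(kL _ kr) => j dj; rewrite krE /l mxE (k0 _ dj) add0r.
    by rewrite mxE (vD _ dj) mulr0.
  - have md : mdiff k (chart_at x) id x.
      exact: smooth_transition_mdiff (sk x).1 kx (chart_at_dom x).
    rewrite /mdiff -l0 in md.
    have := is_derive1_comp dl md.
    suff -> : 'd (cmap (chart_at x) \o id \o cinv k) (l 0) (v *m D) = v by [].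
    rewrite -mul_jacobian l0 -jacE -(chart_inv_diffE kx) -mulmxA.
    by rewrite -/E DE mulmx1.
move=> v; split => [/tP vD|].
  rewrite -[v]mulmx1 -DE mulmxA; apply: submxMr.
  apply/submxP; exists (\row_i (v *m D) 0 (widen_ord dm i)).
  apply/rowP => j; rewrite [RHS]mxE.
  have [jd|dj] := ltnP j d.
    rewrite (bigD1 (Ordinal jd))//= big1 => [|i ij].
      rewrite addr0 [X in _ = _ * X]mxE eqxx jd mulr1 [RHS]mxE; congr ((v *m D) 0 _).
      exact: val_inj.
    rewrite !mxE; case: eqP => [E'|_]; last by rewrite mulr0.
    by case/eqP: ij; apply: val_inj.
  rewrite (vD _ dj) big1// => i _; rewrite !mxE.
  case: eqP => [E'|_]; last by rewrite mulr0.
  by move: dj; rewrite -E' leqNgt ltn_ord.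
move=> /submxP[A ->]; apply/tP => j dj.
rewrite -!mulmxA ED mulmx1 mxE big1// => i _.
rewrite !mxE; case: eqP => [ij|_]; last by rewrite mulr0.
by move: dj; rewrite -ij leqNgt ltn_ord.
Qed.

End TangentSpace.

(** * Arguments of the squared determinant *)

Section Det2.
Context {R : realType} {n : nat}.
Implicit Types (F : 'M[R]_(n, n + n)).

Lemma sum_Complex (I : finType) (f g : I -> R) :
  \sum_i Complex (f i) (g i) = Complex (\sum_i f i) (\sum_i g i) :> R[i].
Proof. by elim/big_rec3: _ => // i x y z _ ->. Qed.

Lemma mul_Complex (a b c d : R) :
  Complex a b * Complex c d = Complex (a * c - b * d) (a * d + b * c) :> R[i].
Proof. by []. Qed.

(** Write F = (X Y) and C = X + i Y. The product of C with its conjugate transpose has imaginary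
    part Y X^T - X Y^T, zero by isotropy, and real part the Gram matrix of [F], invertible because
    the rows are independent. *)
Lemma det_complex_mx_neq0 F : row_free F -> F *m std_form *m F^T = 0 ->
  \det (complex_mx F) != 0.
Proof.
move=> Ff Fiso.
have uF : F *m F^T \in unitmx.
  apply: unitmx_inj => v; rewrite mulmxA => vF0.
  apply: (row_free_inj Ff); rewrite mul0mx.
  have : (v *m F) *m (v *m F)^T = 0 by rewrite trmx_mul mulmxA vF0 mul0mx.
  move=> /matrixP/(_ 0 0); rewrite mxE [RHS]mxE => /eqP.
  rewrite psumr_eq0 => [/allP H|i _]; last by rewrite !mxE -expr2 sqr_ge0.
  apply/rowP => i; have := H i (mem_index_enum i).
  by rewrite !mxE -expr2 sqrf_eq0 => /eqP.
have XY : lsubmx F *m (rsubmx F)^T = rsubmx F *m (lsubmx F)^T.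
  move: Fiso; rewrite -{1 2}(hsubmxK F) /std_form mul_row_block !mulmx0 tr_row_mx.
  rewrite mulmxN !mulmx1 add0r addr0 mul_row_col mulNmx addrC => /eqP.
  by rewrite subr_eq0 => /eqP.
have FF : F *m F^T = lsubmx F *m (lsubmx F)^T + rsubmx F *m (rsubmx F)^T.
  by rewrite -{1 2}(hsubmxK F) tr_row_mx mul_row_col.
pose D : 'M[R[i]]_n := \matrix_(j, k) Complex (F k (lshift n j)) (- F k (rshift n j)).
have CD : complex_mx F *m D = map_mx (real_complex R) (F *m F^T).
  apply/matrixP => i j; rewrite FF mxE.
  under eq_bigr do rewrite !mxE mul_Complex.
  rewrite sum_Complex !mxE; congr Complex.
    rewrite -big_split /=; apply: eq_bigr => k _; rewrite !mxE; ring.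
  move/matrixP/(_ i j) : XY; rewrite !mxE => /eqP; rewrite -subr_eq0 -sumrB.
  rewrite -oppr_eq0 -sumrN => /eqP E; rewrite -[RHS]E.
  by apply: eq_bigr => k _; rewrite !mxE; ring.
have : \det (complex_mx F *m D) != 0.
  rewrite CD det_map_mx; move: uF; rewrite unitmxE unitfE.
  by apply: contra; rewrite eq_complex /= => /andP[].
by rewrite det_mulmx mulf_eq0 negb_or => /andP[].
Qed.

Variable c : 'I_n -> int.

Lemma complex_mx_rot F t : complex_mx (F *m rotmx c t) =
  complex_mx F *m diag_mx (\row_k Complex (cos (t *~ c k)) (sin (t *~ c k))).
Proof.
rewrite -{1}(hsubmxK F) /rotmx mul_row_block.
apply/matrixP => i j; rewrite mul_mx_diag [LHS]mxE row_mxEl row_mxEr.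
rewrite mulmxN !mul_mx_diag !mxE mul_Complex.
by congr Complex; rewrite ?mxE; ring.
Qed.

Lemma prod_Complex (I : finType) (f : I -> R) :
  \prod_i Complex (cos (f i)) (sin (f i)) =
  Complex (cos (\sum_i f i)) (sin (\sum_i f i)) :> R[i].
Proof.
elim/big_rec2: _ => [|i x y _ ->]; first by rewrite cos0 sin0.
by rewrite mul_Complex cosD sinD; congr Complex; ring.
Qed.

(** The rotation multiplies the complex matrix by diag(e^(i t c_k)), hence its determinant by e^(i t
    sum c_k); squaring doubles the angle. *)
Lemma det2_arg_rot F t th : det2_arg F th ->
  det2_arg (F *m rotmx c t) (th + 2 * (t *~ \sum_k c k)).
Proof.
move=> [r r0 E]; exists r => //.
rewrite complex_mx_rot det_mulmx det_diag.
under eq_bigr do rewrite mxE.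
rewrite prod_Complex exprMn E -mulrz_sumr; set s := t *~ _.
have -> : th + 2 * s = th + (s + s) by ring.
rewrite expr2 !mul_Complex !(cosD, sinD).
by congr Complex; ring.
Qed.

Lemma ex_det2_arg F : row_free F -> F *m std_form *m F^T = 0 ->
  exists th, det2_arg F th.
Proof.
move=> Ff Fiso; have := det_complex_mx_neq0 Ff Fiso.
rewrite -sqrf_eq0 /det2_arg; case: (_ ^+ 2) => x y xy0.
have [|r r0 [t [-> ->]]] := @ex_polar_form R x y.
  by move: xy0; rewrite eq_complex -pair_eqE.
by exists t, r.
Qed.

End Det2.

(** * The Maslov index of the gradient disc *)

Section Maslov.
Context {R : realType} {n : nat} {M : manifold R (n + n)}.
Variables (w : M -> 'M[R]_(n + n)) (a : R -> M -> M) (H : M -> R) (L : set M).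
Variables (J : M -> 'M[R]_(n + n)) (g : R -> M -> M) (p z : M) (u : R * R -> M).
Variable (c : 'I_n -> int).
Hypothesis w_symplectic : symplectic_form w.
Hypothesis a_hamiltonian : hamiltonian_S1_action w a H.
Hypothesis L_lagrangian : lagrangian w L.
Hypothesis L_invariant : forall t x, L x -> L (a t x).
Hypothesis J_compatible : compatible_acs w J.
Hypothesis J_invariant : invariant_acs a J.
Hypothesis g_flow : is_flow g (fun x => generator a x *m J x).
Hypothesis p_in_L : L p.
Hypothesis u_disc : gradient_disc a g p z u.
Hypothesis c_weights : weights_at w a H z c.
Notation disc := (disc : set (R * R)).

Lemma weights_rot (f : chart R M (n + n)) x t : cdom f x ->
  (forall t k, let th := t *~ c k in
    xc (cmap f (a t x)) k =
      cos th * xc (cmap f x) k - sin th * yc (cmap f x) k /\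
    yc (cmap f (a t x)) k =
      sin th * xc (cmap f x) k + cos th * yc (cmap f x) k) ->
  cmap f (a t x) = cmap f x *m rotmx c t.
Proof.
move=> fx E; rewrite -[RHS]hsubmxK -[LHS]hsubmxK.
rewrite -(hsubmxK (cmap f x)) /rotmx mul_row_block !mulmxN.
rewrite !mul_mx_diag row_mxKl row_mxKr.
by congr row_mx; apply/rowP => k; have [E1 E2] := E t k;
  rewrite !mxE; [apply: etrans E1 _|apply: etrans E2 _];
  rewrite /xc /yc; ring.
Qed.

Lemma ex_equivariant_trivialization : exists Phi : R * R -> 'M[R]_(n + n),
  eframe a c u Phi /\ symplectic_trivialization w u Phi.
Proof.
have [[a_act a2pi] w_inv _] := a_hamiltonian.
have [f [sf fz f0 fw fa]] := c_weights.
have [] := ex_jframe (c := c) a_act J_compatible J_invariant g_flow u_disc sf fz fw.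
- by move=> t x fx; have [/(_ t)] := fa x fx.
- by move=> t x fx; apply: weights_rot => //; have [] := fa x fx.
move=> X jX.
have ue : equivariant_disc a u.
  split=> [t q qd|q qd]; first exact: (gdisc_rot a_act J_invariant g_flow u_disc).
  exact: (gdisc_cvg u_disc).
have [Phi [Phie Phiw]] := ex_unitary_frame w_symplectic J_compatible J_invariant
  w_inv ue jX.
exists Phi; split => //; split => // x.
apply/subspace_continuousP => q [qd qx].
have := Phie.2 q qd x qx.
apply: cvg_trans; apply: cvg_fmap2; exact: within_subset.
Qed.

(** Written with a double negation to match [gdisc_rot]: moving counterclockwise by [t] is acting by
    [- t]. *)
Lemma unit_circle t : (cos t, sin t) = rot (- (- t)) (1, 0) :> R * R.
Proof. by rewrite opprK /rot /= !mulr1 !mulr0 subr0 addr0. Qed.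

Lemma maslov_weights : maslov_index w L u (- 2 * \sum_k c k).
Proof.
have [[a_act a2pi] w_inv _] := a_hamiltonian.
have [Phi [[Phie Phic] [Phiw Phit]]] := ex_equivariant_trivialization.
have q0d : disc (1, 0) by rewrite /Defs.disc /= expr1n expr0n addr0.
have u0 : u (1, 0) = p.
  have := gdisc_polar u_disc 0 (lexx 0).
  rewrite /polar !oppr0 expR0 cos0 sin0 !mul1r (ract0 a_act).
  by rewrite (ract0 g_flow.1).
have ut t : u (cos t, sin t) = a (- t) p.
  by rewrite unit_circle (gdisc_rot a_act J_invariant g_flow u_disc)// u0.
split.
- exact: (gdisc_continuous u_disc).
- by move=> t; rewrite ut; exact: L_invariant.
exists Phi; split; first by split.
have [F1 [F1f F1T]] := tangent_toP p_in_L (L_lagrangian.1 p p_in_L).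
set P0 := Phi (1, 0).
have P0w : P0 *m w p *m P0^T = std_form by rewrite /P0 -u0; exact: Phiw.
have P0u : P0 \in unitmx.
  have : (std_form : 'M[R]_(n + n)) \in unitmx.
    exact: (mulmx1_unit (std_acs_form)).2.
  by rewrite -P0w -mulmxA unitmx_mul => /andP[].
(* The tangent space of [L] at [p], read in the trivialization; its rotations give the whole
   loop. *)
pose F0 := F1 *m invmx P0.
have F0P : F0 *m P0 = F1 by rewrite /F0 mulmxKV.
have F0f : row_free F0.
  by rewrite /row_free mxrankMfree// row_free_unit unitmx_inv.
have F0i : F0 *m std_form *m F0^T = 0.
  rewrite -P0w !mulmxA F0P -mulmxA -trmx_mul F0P.
  apply/matrixP => i j; rewrite [RHS]mxE.
  have := L_lagrangian.2 p (row i F1) (row j F1) p_in_L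
    ((F1T _).2 (row_sub _ _)) ((F1T _).2 (row_sub _ _)).
  move=> <-; rewrite /ev -row_mul [LHS]mxE [RHS]mxE; apply: eq_bigr => k _.
  by congr (_ * _); rewrite !mxE.
have [th0 F0th] := ex_det2_arg F0f F0i.
(* Time [- t] of the action rotates by -t sum c_k, doubled by the square; over one turn the argument
   changes by 2 pi times the claimed index. *)
exists (fun t => th0 + 2 * ((- t) *~ \sum_k c k)); split.
- move=> t; apply: cvgD; first exact: cvg_cst.
  apply: cvgM; first exact: cvg_cst.
  under eq_cvg do rewrite -mulrzr.
  rewrite -mulrzr; apply: cvgM; last exact: cvg_cst.
  by apply: cvgN; exact: cvg_id.
- rewrite oppr0 mul0rz mulr0 addr0 addrAC subrr add0r.
  rewrite -(mulrzr (- _)) -(mulrzr (2 * pi)) intrM.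
  have -> : (-2)%:~R = - 2 :> R by [].
  ring.
(* Phi at angle [t] is [rotmx c t] times [P0] times the differential of [a (- t)]. The rotations
   cancel and leave [F1] transported by the action to the tangent space at a_(-t) p. *)
move=> t /=; exists (F0 *m rotmx c (- t)); split.
- rewrite /row_free mxrankMfree; first exact: F0f.
  by rewrite row_free_unit; exact: (mulmx1_unit (rotmxK c t)).1.
- move=> v; rewrite ut unit_circle (Phie (- t) _ q0d) u0.
  rewrite opprK.
  have -> : F0 *m rotmx c (- t) *m (rotmx c t *m Phi (1, 0) *m tangent_map (a (- t)) p)
    = F1 *m tangent_map (a (- t)) p.
    rewrite !mulmxA -(mulmxA F0) rotmxK mulmx1.
    by rewrite -/P0 F0P.
  exact: tangent_to_act_iff a_act L_invariant F1T v.
- exact: det2_arg_rot.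
Qed.

End Maslov.

(** * The fixed component *)

Section SmoothLinear.
Context {R : realType}.

Lemma mulmx_continuous m l (P : 'M[R]_(m, l)) :
  continuous (mulmx^~ P : 'rV[R]_m -> 'rV[R]_l).
Proof. by move=> x; apply: differentiable_continuous; exact: (jacobian_mulmx _ _).1. Qed.

Lemma Ck_on_sub (V W : normedModType R) k (U U' : set V) (f : V -> W) :
  U' `<=` U -> Ck_on k U f -> Ck_on k U' f.
Proof.
move=> UU'; elim: k f => [|k IH] f /=; first by move=> cf x /UU'; exact: cf.
by move=> [df cf]; split=> [x /UU'|v]; [exact: df|exact: IH].
Qed.

Lemma Ck_on_eq (V W : normedModType R) k (U : set V) (f f' : V -> W) :
  open U -> (forall x, U x -> f x = f' x) -> Ck_on k U f -> Ck_on k U f'.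
Proof.
move=> oU; elim: k f f' => [|k IH] f f' ff' /=.
  move=> cf x Ux.
  have E : \forall y \near x, f' y = f y.
    by apply: filterS (open_nbhs_nbhs (conj oU Ux)) => y /ff'.
  apply: (near_eq_cvgl (nbhs_filter x) (cf x Ux) _ E).
  by rewrite ff'.
have near_ff' x : U x -> \forall y \near x, f y = f' y.
  by move=> Ux; apply: filterS (open_nbhs_nbhs (conj oU Ux)) => y /ff'.
move=> [df cf]; split=> [x Ux|v].
  exact: (near_diff_eq (near_ff' x Ux) (df x Ux)).1.
apply: IH (cf v) => x Ux; apply: near_eq_derive; exact: near_ff'.
Qed.

Lemma Ck_on_mulmxr (V : normedModType R) m l k (U : set V)
    (f : V -> 'rV[R]_m) (P : 'M[R]_(m, l)) :
  open U -> Ck_on k U f -> Ck_on k U (fun x => f x *m P).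
Proof.
move=> oU; elim: k f => [|k IH] f /=.
  move=> cf x Ux; apply: cvg_mulmx; [exact: cf|exact: cvg_cst].
move=> [df cf].
have dP x : U x -> differentiable ((mulmx^~ P) \o f) x.
  by move=> Ux; apply: differentiable_comp (df x Ux) (jacobian_mulmx _ _).1.
split=> [x Ux|v]; first exact: dP.
apply: (Ck_on_eq oU _ (IH _ (cf v))) => x Ux.
rewrite [RHS](deriveE _ (dP x Ux)).
have -> : 'd ((mulmx^~ P) \o f) x v =
    'd (mulmx^~ P : 'rV[R]_m -> 'rV[R]_l) (f x) ('d f x v).
  by rewrite diff_comp//; [exact: df|exact: (jacobian_mulmx _ _).1].
by rewrite -mul_jacobian (jacobian_mulmx _ _).2 -(deriveE _ (df x Ux)).
Qed.

Lemma Ck_on_mulmxl (W : normedModType R) m l k (U : set 'rV[R]_m)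
    (f : 'rV[R]_m -> W) (P : 'M[R]_(l, m)) :
  Ck_on k U f -> Ck_on k [set y | U (y *m P)] (fun y : 'rV[R]_l => f (y *m P)).
Proof.
elim: k f => [|k IH] f /=.
  move=> cf x Ux; exact: (@continuous_comp _ _ _ (mulmx^~ P : 'rV[R]_l -> 'rV[R]_m) f x
    (@mulmx_continuous _ _ P x) (cf _ Ux)).
move=> [df cf]; split=> [x Ux|v].
  by apply: (differentiable_comp (jacobian_mulmx P x).1); exact: df.
(* The difference quotients coincide, so this is an equality of total functions, valid even where
   [f] is not differentiable. *)
suff -> : 'D_v (fun y : 'rV_l => f (y *m P)) =
    (fun y => 'D_(v *m P) f (y *m P)) by exact: (IH _ (cf (v *m P))).
apply/funext => y; rewrite /derive.
suff -> : (fun h => h^-1 *: (((fun y : 'rV_l => f (y *m P)) \o shift y) (h *: v)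
      - f (y *m P))) =
    (fun h => h^-1 *: ((f \o shift (y *m P)) (h *: (v *m P)) - f (y *m P))) by [].
by apply/funext => h /=; rewrite mulmxDl scalemxAl.
Qed.

Section LinearChart.
Context {m : nat} {M : manifold R m}.
Variables (f : chart R M m) (P : 'M[R]_m) (W : set 'rV[R]_m).
Hypothesis P_unit : P \in unitmx.
Hypothesis W_open : open W.

Let ldom : set M := cdom f `&` cmap f @^-1` W.
Let lmap (x : M) := cmap f x *m P.
Let linv y := cinv f (y *m invmx P).

Lemma lin_chart_dom_open : open ldom.
Proof.
rewrite openE => x [fx Wx].
apply: filterI; first exact: near_cdom.
by apply: (cmap_continuous fx); apply: open_nbhs_nbhs.
Qed.

Lemma lin_chart_im_open : open (lmap @` ldom).
Proof.
suff -> : lmap @` ldom = (mulmx^~ (invmx P)) @^-1` (cim f `&` W).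
  by apply: open_comp => [y _|]; [exact: mulmx_continuous|
    apply: openI => //; exact: cim_open].
apply/seteqP; split=> y /=.
  move=> [x [fx Wx] <-]; rewrite /lmap mulmxK//; split => //.
  by exists x.
move=> [[x fx xy] Wy]; exists x; last by rewrite /lmap xy mulmxKV.
by split => //; rewrite /preimage /= xy.
Qed.

Lemma lin_chartK x : ldom x -> linv (lmap x) = x.
Proof. by move=> [fx _]; rewrite /linv /lmap mulmxK// (cmapK fx). Qed.

Lemma lin_cmap_continuous x : ldom x -> {for x, continuous lmap}.
Proof.
move=> [fx _]; exact: (@continuous_comp _ _ _ (cmap f) (mulmx^~ P : 'rV[R]_m -> 'rV[R]_m) x
  (cmap_continuous fx) (@mulmx_continuous _ _ P (cmap f x))).
Qed.

Lemma lin_cinv_continuous x : ldom x -> {for lmap x, continuous linv}.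
Proof.
move=> [fx _]; apply: (@continuous_comp _ _ _ (mulmx^~ (invmx P) : 'rV[R]_m -> 'rV[R]_m) (cinv f)
  (lmap x) (@mulmx_continuous _ _ _ _)).
by rewrite /lmap (mulmxK P_unit); exact: cinv_continuous.
Qed.

(** [P] will permute the coordinates, since [submanifold_at] wants the vanishing ones last; [W] will
    be a ball, so that segments to the centre stay in the chart. *)
Definition lin_chart : chart R M m :=
  @Chart R M m ldom lmap linv lin_chart_dom_open lin_chart_im_open lin_chartK
    lin_cmap_continuous lin_cinv_continuous.

Lemma transition_open (k d : chart R M m) :
  open (cmap k @` (cdom k `&` cdom d)).
Proof.
rewrite openE => _ [x [kx dx] <-].
apply: filterS (chart_near kx (near_cdom dx)) => y [ky dy yE].
by exists (cinv k y).
Qed.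

Lemma lin_chart_smooth : smooth_chart f -> smooth_chart lin_chart.
Proof.
move=> sf x; have [s1 s2] := sf x; split => k.
  apply: (Ck_on_sub _ (Ck_on_mulmxl (invmx P) (s1 k))).
  move=> _ [y [[fy _] xy] <-] /=; rewrite /lmap mulmxK//.
  by exists y.
have H : Ck_on k (cmap (chart_at x) @` (cdom (chart_at x) `&` cdom f))
    (cmap lin_chart \o cinv (chart_at x)).
  by apply: (@Ck_on_mulmxr _ _ _ _ _ (cmap f \o cinv (chart_at x)) P);
    [exact: transition_open|exact: (s2 k)].
by apply: (Ck_on_sub _ H) => _ [y [xy [fy _]] <-]; exists y.
Qed.

End LinearChart.
End SmoothLinear.

(** * Fixed points in the linearizing chart *)

Section FixedComponent.
Context {R : realType} {n : nat} {M : manifold R (n + n)}.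
Variables (a : R -> M -> M) (H : M -> R) (z : M) (c : 'I_n -> int).
Variable f : chart R M (n + n).
Hypothesis f_smooth : smooth_chart f.
Hypothesis f_z : cdom f z.
Hypothesis f_0 : cmap f z = 0.
Hypothesis f_inv : forall t x, cdom f x -> cdom f (a t x).
Hypothesis f_rot : forall t x k, cdom f x ->
  let th := t *~ c k in
  xc (cmap f (a t x)) k = cos th * xc (cmap f x) k - sin th * yc (cmap f x) k /\
  yc (cmap f (a t x)) k = sin th * xc (cmap f x) k + cos th * yc (cmap f x) k.
Hypothesis f_H : forall x, cdom f x -> H x = H z +
  2^-1 * \sum_k (c k)%:~R * (xc (cmap f x) k ^+ 2 + yc (cmap f x) k ^+ 2).

Lemma row_xyP (y y' : 'rV[R]_(n + n)) :
  (forall k, xc y k = xc y' k /\ yc y k = yc y' k) -> y = y'.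
Proof.
move=> E; apply/rowP => i; rewrite -(@fintype.splitK n n i).
by case: (fintype.split i) => k /=; have [] := E k.
Qed.

Lemma angleE (k : 'I_n) (s : R) : c k != 0 -> (s / (c k)%:~R) *~ c k = s.
Proof. by move=> ck; rewrite -mulrzr divfK// intr_eq0. Qed.

Lemma act_eqP t x : cdom f x ->
  (forall k, let th := t *~ c k in
    (cos th = 1 /\ sin th = 0) \/ (xc (cmap f x) k = 0 /\ yc (cmap f x) k = 0)) ->
  a t x = x.
Proof.
move=> fx Hk; rewrite -[RHS](cmapK fx) -[LHS](cmapK (f_inv t fx)); congr cinv.
apply: row_xyP => k; have [-> ->] := f_rot t k fx.
by case: (Hk k) => -[-> ->]; split; ring.
Qed.

Lemma fixed_pointsP x : cdom f x -> fixed_points a x <->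
  forall k, c k != 0 -> xc (cmap f x) k = 0 /\ yc (cmap f x) k = 0.
Proof.
move=> fx; split=> [fix_x k ck|xy0 t].
  (* At time pi / c_k the coordinate z_k is negated, so a fixed point has z_k = 0. *)
  have [] := f_rot (pi / (c k)%:~R) k fx.
  rewrite (angleE _ ck) cospi sinpi fix_x => E1 E2; split; lra.
apply: act_eqP => // k th; have [ck|/xy0] := eqVneq (c k) 0; last by right.
by left; rewrite /th ck mulr0z cos0 sin0.
Qed.

(** A point whose only nonzero coordinate is z_k isolates the weight c_k, both in [H] and in the
    action. *)
Lemma ex_axis_point (k : 'I_n) : exists2 x, cdom f x &
  exists2 r : R, 0 < r & forall l,
    xc (cmap f x) l = r * (l == k)%:R /\ yc (cmap f x) l = 0.
Proof.
pose d : 'rV[R]_(n + n) := delta_mx 0 (lshift n k).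
have cd : {for (0 : R), continuous (fun r : R => 0 + r *: d)}.
  have [/derivable1_diffP D _] := is_derive1_line 0 d (0 : R).
  exact: differentiable_continuous D.
have cimz : nbhs (0 + 0 *: d) (cim f).
  rewrite scale0r addr0 -f_0; apply: open_nbhs_nbhs; split; first exact: cim_open.
  by exists z.
have /nbhs_ballP[e /= e0 eP] : \forall r \near (0 : R), cim f (0 + r *: d).
  exact: cd _ cimz.
have [x fx xE] : cim f (0 + (e / 2) *: d).
  apply: eP; rewrite /ball/= sub0r normrN gtr0_norm ?divr_gt0//.
  by rewrite gtr_pMr// invf_lt1// ltr1n.
exists x => //; exists (e / 2); first by rewrite divr_gt0.
move=> l; rewrite xE /xc /yc !mxE !eqxx /= add0r (inj_eq (@lshift_inj _ _)).
by rewrite eq_rlshift mulr0 add0r.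
Qed.

(** On the z_k-axis H - H(z) is c_k r^2 / 2, so maximality gives c_k <= 0, while freeness off the
    fixed set makes a nonzero c_k a unit of the integers. *)
Lemma weight_semifree_max : semifree a -> (forall x, H x <= H z) ->
  forall k, c k = 0 \/ c k = - 1.
Proof.
move=> sf Hmax k; have [->|ck] := eqVneq (c k) 0; first by left.
have [x fx [r r0 xr]] := ex_axis_point k; right.
have cneg : c k <= 0.
  have := Hmax x; rewrite (f_H fx) gerDl.
  rewrite (bigD1 k)//= big1 => [|l lk].
    rewrite (xr k).1 (xr k).2 eqxx mulr1 expr0n /= !addr0 pmulr_rle0 ?invr_gt0//.
    by rewrite pmulr_lle0 ?exprn_gt0// lerz0.
  by rewrite (xr l).1 (xr l).2 (negPf lk) mulr0 expr0n /= addr0 mulr0.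
have nfix : ~ fixed_points a x.
  move=> /(fixed_pointsP fx)/(_ k ck)[+ _]; rewrite (xr k).1 eqxx mulr1 => E.
  by rewrite E ltxx in r0.
(* At this time z_k, the only nonzero coordinate, has made one full turn, so [x] has returned; the
   time is therefore 2 pi m, that is, c_k m = 1. *)
have [|m mE] := sf x nfix (2 * pi / (c k)%:~R).
  apply: act_eqP => // l th; have [lk|lk] := eqVneq l k.
    left; rewrite /th lk (angleE _ ck).
    by rewrite mulr_natl cos2pi sin2pi.
  by right; rewrite (xr l).1 (xr l).2 (negPf lk) mulr0.
have cm : c k * m = 1.
  have pi0 : 2 * pi != 0 :> R by rewrite mulf_neq0// gt_eqF// pi_gt0.
  have cR : (c k)%:~R != 0 :> R by rewrite intr_eq0.
  apply: (@intr_inj R); rewrite intrM; apply: (mulfI pi0).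
  by rewrite mulr1 mulrCA [2 * pi * m%:~R]mulrzr -mE mulrC divfK.
have : (`|c k| * `|m|)%N = 1%N by rewrite -abszM cm.
move/eqP; rewrite muln_eq1 => /andP[/eqP c1 _].
by move: cneg; rewrite -[c k]opprK oppr_le0 => /gez0_abs; rewrite abszN c1 => <-.
Qed.

Definition weight_at (i : 'I_(n + n)) : int :=
  match fintype.split i with inl k => c k | inr k => c k end.

Lemma weight_lshift k : weight_at (lshift n k) = c k.
Proof. by rewrite /weight_at; have /= -> := @fintype.unsplitK n n (inl k). Qed.

Lemma weight_rshift k : weight_at (rshift n k) = c k.
Proof. by rewrite /weight_at; have /= -> := @fintype.unsplitK n n (inr k). Qed.

Lemma fixed_pointsP' x : cdom f x -> fixed_points a x <->
  forall i, weight_at i != 0 -> cmap f x 0 i = 0.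
Proof.
move=> fx; rewrite (fixed_pointsP fx); split=> [E i|E k ck].
  rewrite -(@fintype.splitK n n i); case: (fintype.split i) => k /=.
    by rewrite weight_lshift => /E[].
  by rewrite weight_rshift => /E[].
by split; apply: E; rewrite ?weight_lshift ?weight_rshift.
Qed.

(** Near [z] the fixed set is the coordinate subspace of the zero weights. In a ball this subspace
    is star-shaped about the centre, so it lies in the component of [z]. *)
Lemma fixed_component_submanifold :
  submanifold_at (connected_component (fixed_points a) z)
    #|[set i | weight_at i == 0]%SET| z.
Proof.
set A := [set i | weight_at i == 0]%SET; split.
  by rewrite (leq_trans (max_card _))// card_ord.
(* All coordinates, those of weight zero first; [sg] is the resulting permutation and [P] its
   matrix. *)
pose s := enum A ++ enum (~: A).
have ss : size s = (n + n)%N.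
  by rewrite size_cat -!cardE cardsC card_ord.
have us : uniq s.
  rewrite cat_uniq !enum_uniq /= andbT; apply/hasPn => i.
  by rewrite !mem_enum inE.
pose sg (j : 'I_(n + n)) := nth j s j.
have sg_inj : injective sg.
  move=> j j'; rewrite /sg (set_nth_default j) ?ss// => /eqP.
  by rewrite nth_uniq ?ss// => /eqP/val_inj.
have sgA j : (sg j \in A) = (j < #|A|)%N.
  rewrite /sg nth_cat -cardE; case: ltnP => jA.
    by rewrite -mem_enum mem_nth// -cardE.
  apply/negbTE; rewrite -finset.in_setC -mem_enum mem_nth// -cardE.
  by rewrite ltn_subLR// cardsC card_ord.
pose P : 'M[R]_(n + n) := \matrix_(i, j) (i == sg j)%:R.
have yP (y : 'rV[R]_(n + n)) j : (y *m P) 0 j = y 0 (sg j).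
  rewrite mxE (bigD1 (sg j))//= mxE eqxx mulr1 big1 ?addr0// => i ij.
  by rewrite mxE (negPf ij) mulr0.
have Pu : P \in unitmx.
  apply: unitmx_inj => y yP0; apply/rowP => i.
  have [j jE] : exists j, sg j = i by exists (invF sg_inj i); rewrite f_invF.
  by rewrite -jE -yP yP0 !mxE.
have cim0 : nbhs (0 : 'rV[R]_(n + n)) (cim f).
  apply: open_nbhs_nbhs; split; first exact: cim_open.
  by exists z.
have /nbhs_ballP[e /= e0 eP] := cim0.
have Wo : open (ball (0 : 'rV[R]_(n + n)) e) by exact: ball_open.
exists (lin_chart f Pu Wo); split.
- exact: lin_chart_smooth.
- by split => //=; rewrite f_0; exact: ballxx.
move=> x [fx Wx]; split => [Cx j jA|x0].
  have /= -> := yP (cmap f x) j.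
  apply: (fixed_pointsP' fx).1; first exact: connected_component_sub Cx.
  by have := sgA j; rewrite finset.inE ltnNge jA => ->.
have x0' i : weight_at i != 0 -> cmap f x 0 i = 0.
  have jE : sg (invF sg_inj i) = i by rewrite f_invF.
  move=> wi; rewrite -jE -yP; apply: x0; rewrite leqNgt -sgA jE finset.inE.
  by [].
(* The segment from the centre to [x]: it stays in the ball and consists of fixed points, because
   the conditions are linear. *)
pose s1 (r : R) := cinv f (r *: cmap f x).
have rW r : 0 <= r <= 1 -> cim f (r *: cmap f x).
  move=> /andP[r0 r1]; apply: eP.
  rewrite -ball_normE /= sub0r normrN normrZ ger0_norm//.
  have : `|cmap f x| < e by move: Wx; rewrite /= -ball_normE /= sub0r normrN.
  by apply: le_lt_trans; rewrite ler_piMl.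
have Cx : connected (s1 @` `[0, 1]%classic).
  apply: connected_continuous_connected; first exact: segment_connected.
  apply: continuous_in_subspaceT => r; rewrite inE /= in_itv /= => r01.
  have [y fy yE] := rW r r01.
  have c1 : {for r, continuous (fun r : R => r *: cmap f x)}.
    exact: scalel_continuous.
  have c2 : {for r *: cmap f x, continuous (cinv f)}.
    by rewrite -yE; exact: cinv_continuous.
  exact: (continuous_comp c1 c2).
apply: (connected_component_max _ _ Cx).
- exists 0; first by rewrite /= in_itv /= lexx ler01.
  by rewrite /s1 scale0r -f_0 (cmapK f_z).
- move=> _ [r /= r01 <-]; rewrite in_itv /= in r01.
  have [y fy yE] := rW r r01.
  rewrite /s1 -yE (cmapK fy); apply/(fixed_pointsP' fy) => i wi.
  by rewrite yE mxE x0'// mulr0.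
- exists 1; first by rewrite /= in_itv /= lexx ler01.
  by rewrite /s1 scale1r (cmapK fx).
Qed.

(** Minus the sum of the weights counts those equal to -1, and each weight belongs to two real
    coordinates, so twice this number is the codimension of the zero-weight subspace. *)
Lemma card_zero_weights : (forall k, c k = 0 \/ c k = -1) ->
  - 2 * \sum_k c k = (n + n)%:Z - #|[set i | weight_at i == 0]%SET|%:Z.
Proof.
move=> c01.
have -> : #|[set i | weight_at i == 0]%SET| = (\sum_k (c k == 0) + \sum_k (c k == 0))%N.
  rewrite cardsE -sum1_card big_mkcond big_split_ord /=.
  congr (_ + _)%N; apply: eq_bigr => k _.
    by rewrite -[_ \in _]/(weight_at (lshift n k) == 0) weight_lshift; case: (c k == 0).
  by rewrite -[_ \in _]/(weight_at (rshift n k) == 0) weight_rshift; case: (c k == 0).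
set s := (\sum_k (c k == 0))%N.
have -> : \sum_k c k = s%:Z - n%:Z.
  rewrite /s (eq_bigr (fun k => (c k == 0)%:Z - 1)) => [|k _]; last first.
    by case: (c01 k) => ->.
  rewrite sumrB sumr_const card_ord; congr (_ - _); last by rewrite natz.
  by rewrite -[RHS]natz natr_sum; apply: eq_bigr => k _; rewrite natz.
by rewrite !PoszD; ring.
Qed.

End FixedComponent.

Theorem theorem1 (R : realType) (n : nat) (M : manifold R (n + n))
    (w : M -> 'M[R]_(n + n)) (a : R -> M -> M) (H : M -> R) (L : set M)
    (w_symplectic : symplectic_form w)
    (a_hamiltonian : hamiltonian_S1_action w a H)
    (a_effective : effective a)
    (L_lagrangian : lagrangian w L)
    (L_invariant : forall t x, L x -> L (a t x))
    (L_level : exists h : R, forall x, L x -> H x = h)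
    (J : M -> 'M[R]_(n + n)) (g : R -> M -> M)
    (J_compatible : compatible_acs w J)
    (J_invariant : invariant_acs a J)
    (g_flow : is_flow g (fun x => generator a x *m J x))
    (p z : M) (u : R * R -> M)
    (p_in_L : L p)
    (u_disc : gradient_disc a g p z u)
    (c : 'I_n -> int)
    (c_weights : weights_at w a H z c) :
  maslov_index w L u (- 2 * \sum_k c k) /\
  (semifree a -> (forall x, H x <= H z) ->
   exists2 d : nat,
     submanifold_at (connected_component (fixed_points a) z) d z
     & maslov_index w L u ((n + n)%:Z - d%:Z)).
Proof.
have ML : maslov_index w L u (- 2 * \sum_k c k).
  exact: (maslov_weights w_symplectic a_hamiltonian L_lagrangian L_invariant
    J_compatible J_invariant g_flow p_in_L u_disc c_weights).
split=> // a_semifree H_max.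
have [f [f_smooth f_z f_0 _ fP]] := c_weights.
have f_inv t x : cdom f x -> cdom f (a t x) by move=> fx; have [+ _ _] := fP x fx.
have f_rot t x k : cdom f x -> let th := t *~ c k in
    xc (cmap f (a t x)) k = cos th * xc (cmap f x) k - sin th * yc (cmap f x) k /\
    yc (cmap f (a t x)) k = sin th * xc (cmap f x) k + cos th * yc (cmap f x) k.
  by move=> fx; have [_ + _] := fP x fx; exact.
have f_H x : cdom f x -> H x = H z + 2^-1 *
    \sum_k (c k)%:~R * (xc (cmap f x) k ^+ 2 + yc (cmap f x) k ^+ 2).
  by move=> fx; have [] := fP x fx.
exists #|[set i | weight_at c i == 0]%SET|.
  exact: (fixed_component_submanifold f_smooth f_z f_0 f_inv f_rot).
rewrite -card_zero_weights//.
exact: (weight_semifree_max f_z f_0 f_inv f_rot f_H).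
Qed.
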